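(* There is an algorithm that, given any $\mathcal{T}_7$-free tournament $T'=(V',A')$ with weight function $w:V'\to\mathbb{Q}_{\ge 0}$, finds in polynomial time a feedback vertex set $F'$ of $T'$ with $w(F')\le \frac{7}{9}\,w(V')$.
   Context: A tournament is an orientation of a complete graph; it is transitive if it contains no directed cycle. A feedback vertex set (FVS) of a tournament $T=(V,A)$ is a set $S\subseteq V$ such that $T[V\setminus S]$ is transitive. $\mathcal{T}_7$ denotes the family of tournaments on $7$ vertices that contain no transitive subtournament on $5$ vertices (equivalently, every FVS of them has size at least $3$). A tournament is $\mathcal{T}_7$-free if it has no $7$-vertex subtournament isomorphic to a member of $\mathcal{T}_7$. For $S\subseteq V'$, $w(S)=\sum_{v\in S}w(v)$. *)

(* Defs.v *)
From HB Require Import structures.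
From mathcomp Require Import all_boot all_order all_algebra.

Set Implicit Arguments.
Unset Strict Implicit.
Unset Printing Implicit Defensive.

Import GRing.Theory Num.Theory.

Record tournament (V : finType) := Tournament {
  arc :> rel V;
  arc_irreflexive : irreflexive arc;
  arc_orientation : forall x y, x != y -> arc x y (+) arc y x }.

Definition transitive_tournament (V : finType) (T : tournament V) : Prop :=
  ~ exists2 c : seq V, c != [::] & ucycle T c.

Section Induced.
Variables (V : finType) (T : tournament V) (S : {set V}).

Let induced_arc : rel {x : V | x \in S} := fun x y => T (val x) (val y).

Fact induced_irreflexive : irreflexive induced_arc.
Proof. by move=> x; apply: arc_irreflexive. Qed.

Fact induced_orientation x y :
  x != y -> induced_arc x y (+) induced_arc y x.
Proof. by move=> nxy; apply: arc_orientation; rewrite (inj_eq val_inj). Qed.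

Definition induced : tournament {x : V | x \in S} :=
  Tournament induced_irreflexive induced_orientation.

End Induced.

Definition feedback_vertex_set (V : finType) (T : tournament V) (S : {set V}) :=
  transitive_tournament (induced T (~: S)).

Definition isomorphic (U V : finType) (T : tournament U) (T' : tournament V) :=
  exists2 f : U -> V, bijective f & forall x y, T' (f x) (f y) = T x y.

Definition in_T7 (V : finType) (T : tournament V) : Prop :=
  #|V| = 7 /\
  forall S : {set V}, #|S| = 5 -> ~ transitive_tournament (induced T S).

Definition T7_free (V : finType) (T : tournament V) : Prop :=
  forall (U : finType) (T' : tournament U), in_T7 T' ->
  forall S : {set V}, #|S| = 7 -> ~ isomorphic (induced T S) T'.

Definition weight (V : finType) (w : V -> rat) (S : {set V}) : rat :=
  (\sum_(v in S) w v)%R.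

(** Polynomial time is measured on a random access machine under the
    logarithmic cost criterion (Aho, Hopcroft and Ullman), which is polynomially
    equivalent to a Turing machine.  Programs are structured (while loops
    instead of jumps), and the memory is split into arrays: a program mentions
    finitely many of them, by literal names, while the indices are computed at
    run time. *)

Definition memory := nat -> nat -> nat.

Inductive binop := Add | Sub | Mul | Div | Leq | Eqn.

Definition eval_binop (o : binop) : nat -> nat -> nat :=
  match o with
  | Add => addn
  | Sub => subn
  | Mul => muln
  | Div => divn
  | Leq => fun m n => nat_of_bool (m <= n)
  | Eqn => fun m n => nat_of_bool (m == n)
  end.

Inductive expr :=
  | Const of nat
  | Get of nat & expr
  | Bin of binop & expr & expr.

Inductive cmd :=
  | Skip
  | Set_ of nat & expr & expr
  | Seq of cmd & cmd
  | If of expr & cmd & cmd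
  | While of expr & cmd.

Fixpoint eval (m : memory) (e : expr) : nat :=
  match e with
  | Const n => n
  | Get a i => m a (eval m i)
  | Bin o e1 e2 => eval_binop o (eval m e1) (eval m e2)
  end.

(** Length of the binary representation; [bits 0 = 0]. *)
Definition bits (n : nat) : nat := up_log 2 n.+1.

(** Every node pays for the length of its value; operands and addresses are
    thereby paid for by the subexpressions that compute them. *)
Fixpoint expr_cost (m : memory) (e : expr) : nat :=
  (bits (eval m e)).+1 +
  match e with
  | Const _ => 0
  | Get _ i => expr_cost m i
  | Bin _ e1 e2 => expr_cost m e1 + expr_cost m e2
  end.

Definition update (m : memory) (a i v : nat) : memory :=
  fun b j => if (b == a) && (j == i) then v else m b j.

(** [exec c m m' t]: started in [m], the program [c] halts in [m'] at cost
    [t]. *)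
Inductive exec : cmd -> memory -> memory -> nat -> Prop :=
  | ExecSkip m : exec Skip m m 1
  | ExecSet a i e m :
      exec (Set_ a i e) m (update m a (eval m i) (eval m e))
           (expr_cost m i + expr_cost m e).+1
  | ExecSeq c1 c2 m1 m2 m3 t1 t2 :
      exec c1 m1 m2 t1 -> exec c2 m2 m3 t2 ->
      exec (Seq c1 c2) m1 m3 (t1 + t2).+1
  | ExecIfTrue e c1 c2 m m' t :
      eval m e != 0 -> exec c1 m m' t ->
      exec (If e c1 c2) m m' (expr_cost m e + t).+1
  | ExecIfFalse e c1 c2 m m' t :
      eval m e = 0 -> exec c2 m m' t ->
      exec (If e c1 c2) m m' (expr_cost m e + t).+1
  | ExecWhileTrue e c m1 m2 m3 t1 t2 :
      eval m1 e != 0 -> exec c m1 m2 t1 -> exec (While e c) m2 m3 t2 ->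
      exec (While e c) m1 m3 (expr_cost m1 e + t1 + t2).+1
  | ExecWhileFalse e c m :
      eval m e = 0 -> exec (While e c) m m (expr_cost m e).+1.

Definition load (s : seq (seq nat)) : memory :=
  fun a i => nth 0 (nth [::] s a) i.

Definition input_size (s : seq (seq nat)) : nat :=
  \sum_(r <- s) \sum_(n <- r) (bits n).+1.

(** The vertices are numbered by their position in [enum V]; the adjacency
    matrix is stored by rows. *)
Definition encode (V : finType) (T : tournament V) (w : V -> rat) :
    seq (seq nat) :=
  [:: [:: #|V| ];
      [seq nat_of_bool (T x y) | x <- enum V, y <- enum V];
      [seq absz (numq (w x)) | x <- enum V];
      [seq absz (denq (w x)) | x <- enum V] ].

(** The output is the characteristic vector stored in array 4. *)
Definition output (V : finType) (m : memory) : {set V} :=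
  [set x : V | m 4 (index x (enum V)) != 0].

(* Main.v *)
From HB Require Import structures.
From mathcomp Require Import all_boot all_order all_algebra.
From mathcomp Require Import zify lra.
Require Import Defs.

Set Implicit Arguments.
Unset Strict Implicit.
Unset Printing Implicit Defensive.

(** Call a vertex set k-obstruction-free if every 2k+1 of its vertices contain
    k+2 that span a transitive tournament; a T7-free tournament is
    3-obstruction-free, and 1-obstruction-free means transitive.  Let k <= 3 and
    let the tournament be k-obstruction-free.  Then the second out-neighbourhood
    of a vertex u is (k-1)-obstruction-free, since otherwise u and an induced
    matching of k arcs would form a k-obstruction; so is N^+(v) :&: N^-(d)
    whenever v is reached from d in at most two steps.

    Starting at a vertex v of minimum out-degree, put v and N^+(v) aside as one
    piece, and its second out-neighbourhood J as another.  In the rest, which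
    dominates v and N^+(v), take as next pivot a king of the third
    out-neighbourhood, and so on.  All the pieces are 2-obstruction-free.  The
    union of the pieces of the first kind, that of the even J's and that of the
    odd J's are ordered sums of such pieces, hence 2-obstruction-free: three
    parts.

    In a 2-obstruction-free part, the distance layers from a vertex of minimum
    out-degree have the property that each triangle meets three consecutive
    layers, so that deleting the layers in one class modulo 3 makes the part
    transitive.  Each vertex is kept by two of the nine sets that arise from
    keeping a single part without one of these classes, so the heaviest of them
    weighs at least 2/9 of the total. *)

(** * Acyclic sets and neighbourhoods *)

Lemma subset_of_card (V : finType) (A : {set V}) m :
  m <= #|A| -> exists2 B : {set V}, B \subset A & #|B| = m.
Proof.
case/card_geqP=> s [us <- sA]; exists [set x in s].
  by apply/subsetP=> x; rewrite inE => /sA.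
by rewrite cardsE; apply/card_uniqP.
Qed.

Lemma card_bigcup_le (I V : finType) (A : {set I}) (F : I -> {set V}) :
  #|\bigcup_(i in A) F i| <= \sum_(i in A) #|F i|.
Proof.
elim/big_rec2: _ => [|i m B _ leBm]; first by rewrite cards0.
by apply: leq_trans (leq_card_setU _ _) _; rewrite leq_add2l.
Qed.

Lemma card_set3_gt2 (V : finType) (x y z : V) :
  (2 < #|[set x; y; z]|) = [&& x != y, x != z & y != z].
Proof.
rewrite setUC cardsU1 cards2 !inE [z == x]eq_sym [z == y]eq_sym.
by case: (x == y); case: (x == z); case: (y == z).
Qed.

Section Converse.
Variables (V : finType) (T : tournament V).

Fact converse_irreflexive : irreflexive (fun x y => T y x).
Proof. exact: arc_irreflexive. Qed.

Fact converse_orientation x y : x != y -> T y x (+) T x y.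
Proof. by rewrite addbC; apply: arc_orientation. Qed.

Definition converse : tournament V :=
  Tournament converse_irreflexive converse_orientation.

End Converse.

Section Tournaments.
Variable V : finType.
Implicit Types (T : tournament V) (A B D S X Y : {set V}).
Implicit Types (d p q u v x y z : V) (k m : nat).

Lemma arcN T x y : x != y -> ~~ T x y -> T y x.
Proof. by move/(arc_orientation T); case: (T x y); case: (T y x). Qed.

Lemma arc_neq T x y : T x y -> x != y.
Proof. by move=> xy; apply: contraTneq xy => ->; rewrite arc_irreflexive. Qed.

Lemma arc_asym T x y : T x y -> T y x -> False.
Proof.
by move=> xy yx; have := arc_orientation T (arc_neq xy); rewrite xy yx.
Qed.

Definition out_nbhd T x := [set y | T x y].

Definition in_nbhd T x := [set y | T y x].

Definition reach T A := \bigcup_(x in A) out_nbhd T x.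

Definition dominates T A B := {in A & B, forall x y, T x y}.

Definition min_outdegree T A v :=
  v \in A /\
  {in A, forall x, #|A :&: out_nbhd T v| <= #|A :&: out_nbhd T x|}.

Lemma reachP T A y : reflect (exists2 x, x \in A & T x y) (y \in reach T A).
Proof.
by apply: (iffP bigcupP) => -[x xA xy]; exists x; rewrite ?inE // in xy *.
Qed.

Lemma arc_reach T A x y : x \in A -> T x y -> y \in reach T A.
Proof. by move=> xA xy; apply/reachP; exists x. Qed.

Lemma reach1 T v : reach T [set v] = out_nbhd T v.
Proof. exact: big_set1. Qed.

Lemma reachS T A B : A \subset B -> reach T A \subset reach T B.
Proof.
by move=> /subsetP sAB; apply/subsetP=> y /reachP[x /sAB]; apply: arc_reach.
Qed.

Lemma arc_unreached T A x y : x \in A -> y \notin reach T A -> x != y -> T y x.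
Proof.
by move=> xA yA /arcN; apply; apply: contraNN yA; apply: arc_reach.
Qed.

Lemma card_out_in T A x :
  #|A :&: out_nbhd T x| + #|A :&: in_nbhd T x| = #|A :\ x|.
Proof.
rewrite -(cardsID (out_nbhd T x) (A :\ x)).
congr (_ + _); apply: eq_card => y; rewrite !inE; case: eqVneq => [->|yx] //=;
  rewrite ?arc_irreflexive ?andbF //.
have := arc_orientation T yx.
by case: (T x y); case: (T y x) => //=; rewrite andbC.
Qed.

Lemma leq_card_out T k A x : #|A| <= k.*2.+1 ->
  k < #|A :&: in_nbhd T x| -> #|A :&: out_nbhd T x| <= k.
Proof.
move=> cA cIn; rewrite leqNgt; apply/negP=> cOut.
have := leq_add cOut cIn; rewrite card_out_in leqNgt => /negP; apply.
rewrite addSn addnS addnn !ltnS.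
by rewrite (leq_trans _ cA) // subset_leq_card // subD1set.
Qed.

Lemma leq_card_reach T m D X : X \subset reach T D ->
  {in D, forall d, #|X :&: out_nbhd T d| <= m} -> #|X| <= #|D| * m.
Proof.
move=> /subsetP covX cD.
apply: (@leq_trans (\sum_(d in D) #|X :&: out_nbhd T d|)).
  apply: leq_trans (card_bigcup_le _ _); apply/subset_leq_card/subsetP=> x xX.
  have /reachP[d dD dx] := covX x xX.
  by apply/bigcupP; exists d; rewrite // !inE xX.
by rewrite -sum_nat_const leq_sum.
Qed.

(* For the converse tournament this says that a vertex of maximum out-degree
   is a king. *)
Lemma min_outdegree_second T A v : min_outdegree T A v ->
  A :&: out_nbhd T v \subset reach (converse T) (A :&: in_nbhd T v).
Proof.
move=> [vA vmin]; apply/subsetP=> x; rewrite !inE => /andP[xA vx].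
have : ~~ (A :&: out_nbhd T x \subset A :&: out_nbhd T v).
  apply: contraTN (vmin x xA) => sub; rewrite -ltnNge; apply: proper_card.
  by apply/properP; split=> //; exists x; rewrite !inE xA ?vx ?arc_irreflexive.
case/subsetPn=> d; rewrite !inE => /andP[dA xd]; rewrite dA /= => nvd.
apply/reachP; exists d => //; rewrite !inE dA (arcN _ nvd) //.
by apply: contraTneq xd => <-; apply/negP=> /(arc_asym vx).
Qed.

Definition acyclic T S :=
  [forall x in S, forall y in S, forall z in S, ~~ [&& T x y, T y z & T z x]].

Lemma acyclicP T S :
  reflect {in S & &, forall x y z, T x y -> T y z -> T z x -> False}
          (acyclic T S).
Proof.
apply: (iffP forall_inP) => [noTri x y z xS yS zS xy yz zx|noTri x xS].
  move/forall_inP/(_ y yS)/forall_inP/(_ z zS): (noTri x xS).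
  by rewrite xy yz zx.
apply/forall_inP=> y yS; apply/forall_inP=> z zS.
by apply/negP=> /and3P[]; apply: noTri.
Qed.

Lemma acyclic_transitive T S : acyclic T S ->
  {in S & &, forall x y z, T x y -> T y z -> T x z}.
Proof.
move=> /acyclicP noTri x y z xS yS zS xy yz.
apply: arcN; last by apply/negP; apply: noTri yz.
by apply: contraTneq xy => <-; apply/negP=> /(arc_asym yz).
Qed.

Lemma acyclicS T S S' : S' \subset S -> acyclic T S -> acyclic T S'.
Proof.
move/subsetP=> sub /acyclicP noTri; apply/acyclicP=> x y z /sub xS /sub yS /sub.
exact: noTri.
Qed.

Lemma acyclic_converse T S : acyclic (converse T) S = acyclic T S.
Proof.
by apply/acyclicP/acyclicP=> noTri x y z xS yS zS xy yz zx;
  apply: (noTri y x z) => //.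
Qed.

Lemma acyclicU T A B : acyclic T A -> acyclic T B -> dominates T A B ->
  acyclic T (A :|: B).
Proof.
move=> /acyclicP acA /acyclicP acB domAB; apply/acyclicP=> x y z.
rewrite !inE => /orP[xA|xB] /orP[yA|yB] /orP[zA|zB] xy yz zx;
  by [apply: (acA x y z) | apply: (acB x y z)
     | apply: arc_asym xy (domAB _ _ _ _) | apply: arc_asym yz (domAB _ _ _ _)
     | apply: arc_asym zx (domAB _ _ _ _)].
Qed.

Lemma acyclic_card_le2 T A : #|A| <= 2 -> acyclic T A.
Proof.
move=> cA; apply/acyclicP=> x y z xA yA zA xy yz zx.
have : 2 < #|A|; last by rewrite ltnNge cA.
apply: (@leq_trans #|[set x; y; z]|).
  by rewrite card_set3_gt2 (arc_neq xy) (arc_neq yz) eq_sym (arc_neq zx).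
by apply/subset_leq_card; rewrite !subUset !sub1set xA yA zA.
Qed.

(** * Obstructions *)

Definition has_acyclic T m A :=
  [exists Y : {set V}, [&& Y \subset A, #|Y| == m & acyclic T Y]].

Lemma has_acyclicP T m A :
  reflect (exists Y, [/\ Y \subset A, #|Y| = m & acyclic T Y])
          (has_acyclic T m A).
Proof.
by apply: (iffP existsP) => -[Y]; [case/and3P=> ? /eqP | case=> ? /eqP] => *;
  exists Y; [split | apply/and3P; split].
Qed.

Lemma has_acyclic_le T m A : acyclic T A -> m <= #|A| -> has_acyclic T m A.
Proof.
move=> acA /subset_of_card[Y YA cY]; apply/has_acyclicP; exists Y; split=> //.
exact: acyclicS acA.
Qed.

Lemma has_acyclicS T m A B :
  A \subset B -> has_acyclic T m A -> has_acyclic T m B.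
Proof.
move=> AB /has_acyclicP[Y [YA cY acY]]; apply/has_acyclicP; exists Y.
by split=> //; apply: subset_trans AB.
Qed.

Lemma has_acyclic_le2 T m A : m <= 2 -> m <= #|A| -> has_acyclic T m A.
Proof.
move=> m2 /subset_of_card[Y YA cY]; apply: has_acyclicS YA _.
by apply: has_acyclic_le; rewrite ?acyclic_card_le2 ?cY.
Qed.

Lemma has_acyclicU T m1 m2 A B : dominates T A B ->
  has_acyclic T m1 A -> has_acyclic T m2 B -> has_acyclic T (m1 + m2) (A :|: B).
Proof.
move=> domAB /has_acyclicP[Y [/subsetP YA cY acY]].
move=> /has_acyclicP[Z [/subsetP ZB cZ acZ]]; apply/has_acyclicP.
have domYZ : dominates T Y Z by move=> x y /YA xA /ZB yB; apply: domAB.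
exists (Y :|: Z); split; [exact/setUSS/subsetP/ZB/subsetP | | exact: acyclicU].
rewrite cardsU cY cZ; suff -> : Y :&: Z = set0 by rewrite cards0 subn0.
apply/setP=> x; rewrite !inE; apply/negP=> /andP[xY xZ].
by have := domYZ x x xY xZ; rewrite arc_irreflexive.
Qed.

Lemma has_acyclic3 T A : 3 < #|A| -> has_acyclic T 3 A.
Proof.
move=> cA; have /card_gt0P[v vA] : 0 < #|A| by lia.
have domOut : dominates T [set v] (A :&: out_nbhd T v).
  by move=> x y /set1P->; rewrite !inE => /andP[].
have domIn : dominates T (A :&: in_nbhd T v) [set v].
  by move=> x y; rewrite !inE => /andP[_ xv] /eqP->.
have has1 : has_acyclic T 1 [set v] by rewrite has_acyclic_le2 ?cards1.
have := card_out_in T A v; have := cardsD1 v A; rewrite vA => cAv cOutIn.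
have [cOut|cIn] := leqP 2 #|A :&: out_nbhd T v|.
  have hasOut := has_acyclic_le2 T (leqnn 2) cOut.
  apply: has_acyclicS (has_acyclicU domOut has1 hasOut).
  by rewrite subUset sub1set vA subsetIl.
have {}cIn : 2 <= #|A :&: in_nbhd T v| by lia.
have hasIn := has_acyclic_le2 T (leqnn 2) cIn.
apply: has_acyclicS (has_acyclicU domIn hasIn has1).
by rewrite subUset sub1set vA subsetIl.
Qed.

Definition obstruction T k X :=
  (#|X| == k.*2.+1) && ~~ has_acyclic T k.+2 X.

Definition obstruction_free T k S :=
  forall X, X \subset S -> ~~ obstruction T k X.

Lemma obstruction_freeP T k S : obstruction_free T k S <->
  forall X, X \subset S -> #|X| = k.*2.+1 -> has_acyclic T k.+2 X.
Proof.
split=> freeS X XS => [cX|].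
  by have := freeS X XS; rewrite /obstruction cX eqxx negbK.
by apply/negP=> /andP[/eqP/(freeS X XS)->].
Qed.

Lemma obstruction_freeS T k A B :
  A \subset B -> obstruction_free T k B -> obstruction_free T k A.
Proof. by move=> AB freeB X XA; apply: freeB; apply: subset_trans AB. Qed.

Lemma obstruction_free_small T k A : #|A| <= k.*2 -> obstruction_free T k A.
Proof.
move=> cA X /subset_leq_card cX; rewrite negb_and -ltnS in cA *.
by rewrite neq_ltn (leq_ltn_trans cX cA).
Qed.

Lemma obstruction_converse T k X :
  obstruction (converse T) k X = obstruction T k X.
Proof.
rewrite /obstruction /has_acyclic.
by under eq_existsb do rewrite acyclic_converse.
Qed.

Lemma obstruction_free_converse T k S :
  obstruction_free T k S -> obstruction_free (converse T) k S.
Proof. by move=> freeS X XS; rewrite obstruction_converse freeS. Qed.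

Lemma obstruction_free1_acyclic T S : obstruction_free T 1 S -> acyclic T S.
Proof.
move/obstruction_freeP=> freeS; apply/acyclicP=> x y z xS yS zS xy yz zx.
pose X := [set x; y; z].
have cX : #|X| = 3.
  apply/eqP; rewrite eqn_leq card_set3_gt2.
  rewrite (arc_neq xy) (arc_neq yz) [x == z]eq_sym (arc_neq zx) andbT.
  by rewrite (leq_trans (leq_card_setU _ _)) // cards1 cards2; case: eqP.
have XS : X \subset S by rewrite !subUset !sub1set xS yS.
have [Y [YX cY acY]] := has_acyclicP _ _ _ (freeS X XS cX).
have {acY} : acyclic T X.
  by have /eqP <- : Y == X by rewrite eqEcard YX cX cY.
by move/acyclicP/(_ x y z); apply; rewrite // !inE eqxx ?orbT.
Qed.

Lemma obstruction_free2U T A B : dominates T A B ->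
  obstruction_free T 2 A -> obstruction_free T 2 B ->
  obstruction_free T 2 (A :|: B).
Proof.
move=> domAB /obstruction_freeP freeA /obstruction_freeP freeB.
apply/obstruction_freeP=> X XAB cX.
have sB : X :\: A \subset B by rewrite subDset.
have domX : dominates T (X :&: A) (X :\: A).
  by move=> x y /setIP[_ xA] /(subsetP sB); apply: domAB.
have cXA : #|X :&: A| + #|X :\: A| = 5 by rewrite cardsID.
have XE : X = (X :&: A) :|: (X :\: A) by rewrite setID.
have two_and_two : 2 <= #|X :&: A| -> 2 <= #|X :\: A| -> has_acyclic T 4 X.
  move=> cA cB; rewrite XE; apply: (has_acyclicU (m1 := 2) (m2 := 2) domX);
    exact: has_acyclic_le2.
case cA: #|X :&: A| cXA => [|[|[|[|[|a]]]]] cXA; rewrite ?addSn in cXA.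
- by rewrite {1}XE (cards0_eq cA) set0U; apply: freeB.
- rewrite XE; apply: (has_acyclicU (m1 := 1) (m2 := 3) domX).
    by apply: has_acyclic_le2; rewrite ?cA.
  by apply: has_acyclic3; lia.
- by apply: two_and_two; lia.
- by apply: two_and_two; lia.
- rewrite XE; apply: (has_acyclicU (m1 := 3) (m2 := 1) domX).
    by apply: has_acyclic3; lia.
  by apply: has_acyclic_le2; lia.
- have XA : X :\: A = set0 by apply: cards0_eq; lia.
  by apply: freeA => //; rewrite -setD_eq0 XA.
Qed.

End Tournaments.

Section Transitive.
Variables (V : finType) (T : tournament V).
Implicit Types (S : {set V}).

Lemma transitive_tournamentP : transitive_tournament T <-> acyclic T setT.
Proof.
split=> [noCycle|acT [[//|x c] _ /andP[cyc _]]].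
  apply/acyclicP=> x y z _ _ _ xy yz zx; apply: noCycle.
  exists [:: x; y; z] => //; apply/andP; rewrite /= xy yz zx !inE negb_or.
  by rewrite (arc_neq xy) (arc_neq yz) eq_sym (arc_neq zx).
have trT : transitive T by move=> y t z; apply: (acyclic_transitive acT).
have /allP/(_ x) := order_path_min trT cyc.
by rewrite mem_rcons inE eqxx arc_irreflexive => /(_ isT).
Qed.

Lemma acyclic_induced S (A : {set {x | x \in S}}) :
  acyclic (induced T S) A = acyclic T (val @: A).
Proof.
apply/acyclicP/acyclicP=> noTri.
  move=> _ _ _ /imsetP[x xA ->] /imsetP[y yA ->] /imsetP[z zA ->].
  exact: noTri.
by move=> x y z xA yA zA; apply: noTri; apply: imset_f.
Qed.

End Transitive.

Lemma transitive_induced (V : finType) (T : tournament V) (S : {set V}) :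
  transitive_tournament (induced T S) <-> acyclic T S.
Proof.
rewrite transitive_tournamentP acyclic_induced.
suff -> : [set val x | x in [set: {x | x \in S}]] = S by [].
apply/setP=> x; apply/imsetP/idP=> [[y _ ->]|xS]; first exact: valP.
by exists (exist _ x xS).
Qed.

Lemma T7_free_obstruction_free (V : finType) (T : tournament V) :
  T7_free T -> obstruction_free T 3 setT.
Proof.
move=> free X _; apply/negP=> /andP[/eqP cX noX].
apply: (free _ (induced T X) _ X cX); last by exists id; [exists id|].
split=> [|S cS].
  by rewrite card_sig -cX; apply: eq_card => x; rewrite inE.
rewrite transitive_induced acyclic_induced; apply/negP.
apply: contra noX => acS.
apply/has_acyclicP; exists (val @: S).
split=> //; last by rewrite card_imset //; apply: val_inj.
by apply/subsetP=> _ /imsetP[x _ ->]; apply: valP.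
Qed.

Section InducedMatching.
Variables (V : finType) (T : tournament V).
Implicit Types (D X Y : {set V}) (d u x y : V) (g : V -> V).

Definition induced_matching u D g :=
  {in D, forall d, [/\ T u d, T d (g d) & T (g d) u]} /\
  {in D &, forall d d', d != d' -> T (g d) d'}.

Definition matching_set u D g := u |: (D :|: g @: D).

Lemma induced_matchingS u D D' g :
  D' \subset D -> induced_matching u D g -> induced_matching u D' g.
Proof.
move=> /subsetP sub [tri cross]; split=> [d /sub/tri //|].
by move=> d d' /sub dD /sub d'D; apply: cross.
Qed.

Section Obstruction.
Variables (u : V) (D : {set V}) (g : V -> V).
Hypothesis matchD : induced_matching u D g.

Lemma induced_matching_inj : {in D &, injective g}.
Proof.
have [tri cross] := matchD; move=> d d' dD d'D egg.
apply: contraTeq isT => /(cross d d' dD d'D); rewrite egg.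
by have [_ d'g _] := tri d' d'D => /(arc_asym d'g).
Qed.

Lemma card_induced_matching : #|matching_set u D g| = #|D|.*2.+1.
Proof.
have [tri _] := matchD.
have uM : u \notin D :|: g @: D.
  rewrite inE; apply/norP; split; first by apply/negP=> /tri[/arc_neq/eqP].
  by apply/imsetP=> -[d /tri[_ _ gdu] eu]; case/eqP: (arc_neq gdu).
have /eqP disj : D :&: g @: D == set0.
  apply/set0Pn=> -[x /setIP[/tri[ux _ _] /imsetP[d /tri[_ _ gdu] ex]]].
  by apply: arc_asym gdu _; rewrite -ex.
rewrite cardsU1 uM cardsU disj cards0 subn0.
by rewrite (card_in_imset induced_matching_inj) addnn add1n.
Qed.

(* If u is in Y, no matching arc is; otherwise two matching arcs in Y would
   close up to a cycle of length 4. *)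
Lemma card_acyclic_induced_matching Y :
  Y \subset matching_set u D g -> acyclic T Y -> #|Y| <= #|D|.+1.
Proof.
have [tri cross] := matchD; move=> /subsetP YM acY.
pose A := D :&: Y; pose B := [set d in D | g d \in Y].
have cY : #|Y| <= (u \in Y) + (#|A| + #|B|).
  rewrite (cardsD1 u) leq_add2l; apply: leq_trans (_ : #|A :|: g @: B| <= _).
    apply/subset_leq_card/subsetP=> x; rewrite !inE => /andP[xu xY].
    move: (YM x xY); rewrite !inE (negPf xu) xY andbT /=.
    case/orP=> [-> //|/imsetP[d dD ex]].
    by rewrite ex imset_f ?orbT // inE dD -ex.
  by rewrite (leq_trans (leq_card_setU _ _)) // leq_add2l leq_imset_card.
have cUI := cardsUI A B.
have cU : #|A :|: B| <= #|D|.
  by apply/subset_leq_card/subsetP=> x; rewrite !inE => /orP[]/andP[].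
suff : (u \in Y) + #|A :&: B| <= 1 by lia.
have [uY|_] := boolP (u \in Y); last first.
  rewrite leqNgt; apply/negP=> /card_gt1P[d [d' []]].
  rewrite !inE => /andP[/andP[dD dY] /andP[_ gY]].
  move=> /andP[/andP[d'D d'Y] /andP[_ gY']] dd'.
  have [[_ dg _] [_ dg' _]] := (tri d dD, tri d' d'D).
  have trY := acyclic_transitive acY.
  apply: (@arc_asym _ T d d'); first by apply: trY dg (cross _ _ _ _ _).
  by apply: trY dg' (cross _ _ _ _ _); rewrite // eq_sym.
rewrite add1n ltnS leqn0 cards_eq0; apply/set0Pn=> -[d].
rewrite !inE => /andP[/andP[dD dY] /andP[_ gY]].
by have [ud dg gu] := tri d dD; apply: (acyclicP _ _ acY u d (g d)).
Qed.

Lemma induced_matching_obstruction : obstruction T #|D| (matching_set u D g).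
Proof.
rewrite /obstruction card_induced_matching eqxx; apply/has_acyclicP.
by case=> Y [YM cY /(card_acyclic_induced_matching YM)]; rewrite cY ltnn.
Qed.

End Obstruction.

Lemma minimal_reach_private X D :
  minset (fun D' => X \subset reach T D') D ->
  {in D, forall d, exists x, [/\ x \in X, T d x &
                              {in D, forall d', T d' x -> d' = d}]}.
Proof.
case/minsetP=> /subsetP covD minD d dD.
have [/existsP[x /and3P[xX dx /forall_inP priv]]|none] :=
    boolP [exists x, [&& x \in X, T d x &
      [forall d' in D, T d' x ==> (d' == d)]]].
  by exists x; split=> // d' /priv/implyP imp /imp/eqP.
suff /minD/(_ (subsetDl _ _))/setP/(_ d) : X \subset reach T (D :\ d).
  by rewrite !inE eqxx dD.
apply/subsetP=> x xX; have /reachP[e eD ex] := covD x xX.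
have [ed|ed] := eqVneq e d; last by apply: arc_reach ex; rewrite !inE ed.
rewrite {e eD}ed in ex; move/existsPn/(_ x): none; rewrite xX ex.
case/forall_inPn=> d' d'D; rewrite negb_imply => /andP[d'x d'd].
by apply: arc_reach d'x; rewrite !inE d'd.
Qed.

Lemma minimal_reach_matching u X D :
  D \subset out_nbhd T u -> X \subset in_nbhd T u ->
  minset (fun D' => X \subset reach T D') D ->
  exists2 g, {in D, forall d, g d \in X} & induced_matching u D g.
Proof.
move=> /subsetP uD /subsetP Xu minD.
have /fin_all_exists[g gP] d : exists x, d \in D -> [/\ x \in X, T d x &
    {in D, forall d', T d' x -> d' = d}].
  have [dD|_] := boolP (d \in D); last by exists d.
  by have [x] := minimal_reach_private minD dD; exists x.
exists g => [d /gP[]//|]; split=> [d dD|d d' dD d'D dd'].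
  have [gX dg _] := gP d dD.
  by have := (uD d dD, Xu _ gX); rewrite !inE => -[].
have [gX _ priv] := gP d dD; apply: arcN; last first.
  by apply: contra dd' => /(priv d' d'D)->.
have := (uD d' d'D, Xu _ gX); rewrite !inE => -[ud' gu].
by apply: contraTneq gu => <-; apply/negP=> /(arc_asym ud').
Qed.

End InducedMatching.

Section Descent.
Variables (V : finType) (T : tournament V) (k : nat) (S : {set V}).
Hypothesis freeS : obstruction_free T k.+1 S.
Implicit Types (D X Y : {set V}) (d p q u v x y : V).

Lemma obstruction_pair X p q : X \subset S -> obstruction T k X ->
  p \in S :\: X -> q \in S :\: X -> p != q ->
  exists Y, [/\ Y \subset X, #|Y| = k.+1 & acyclic T (p |: (q |: Y))].
Proof.
rewrite !inE => XS /andP[/eqP cX noX] /andP[pX pS] /andP[qX qS] pq.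
have /has_acyclicP[Y [YU cY acY]] : has_acyclic T k.+3 (p |: (q |: X)).
  move/obstruction_freeP: freeS; apply.
    by rewrite !subUset !sub1set pS qS.
  by rewrite !cardsU1 !inE negb_or pq pX qX cX; lia.
have acYX : acyclic T (Y :&: X) by apply: acyclicS (subsetIl _ _) acY.
have cYX : #|Y :&: X| <= k.+1.
  rewrite leqNgt; apply: contra noX => cYX.
  exact: has_acyclicS (subsetIr Y X) (has_acyclic_le acYX cYX).
have YE : Y \subset p |: (q |: (Y :&: X)).
  by apply/subsetP=> y yY; move/subsetP/(_ y yY): YU; rewrite !inE yY.
have cE : #|p |: (q |: (Y :&: X))| = #|Y :&: X|.+2.
  by rewrite !cardsU1 !inE negb_or pq (negPf pX) (negPf qX) !andbF.
have cYX' : #|Y :&: X| = k.+1.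
  by apply/eqP; rewrite eqn_leq cYX -2!ltnS -cE -cY subset_leq_card.
have /eqP YpqX : Y == p |: (q |: (Y :&: X)) by rewrite eqEcard YE cE cYX' cY /=.
by exists (Y :&: X); rewrite subsetIr cYX' -YpqX.
Qed.

Lemma obstruction_free_between_arc d v : d \in S -> v \in S -> T d v ->
  obstruction_free T k (S :&: in_nbhd T d :&: out_nbhd T v).
Proof.
move=> dS vS dv X; rewrite !subsetI => /andP[/andP[XS /subsetP Xd] /subsetP vX].
apply/negP=> obsX.
have dX : d \notin X by apply/negP=> /Xd; rewrite inE arc_irreflexive.
have vX' : v \notin X by apply/negP=> /vX; rewrite inE arc_irreflexive.
have [||Y [/subsetP YX cY acY]] := obstruction_pair XS obsX _ _ (arc_neq dv);
  rewrite ?inE ?dX ?vX' //.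
have /card_gt0P[x xY] : 0 < #|Y| by rewrite cY.
have := (Xd _ (YX _ xY), vX _ (YX _ xY)); rewrite !inE => -[xd vx].
by apply: (acyclicP _ _ acY d v x); rewrite // !inE ?eqxx ?xY ?orbT.
Qed.

Lemma obstruction_card_in X d y : X \subset S -> obstruction T k X ->
  X \subset in_nbhd T d -> d \in S -> y \in S -> T d y ->
  k < #|X :&: in_nbhd T y|.
Proof.
move=> XS obsX /subsetP Xd dS yS dy.
have dX : d \notin X by apply/negP=> /Xd; rewrite inE arc_irreflexive.
have yX : y \notin X by apply/negP=> /Xd; rewrite inE => /(arc_asym dy).
have [||Y [/subsetP YX cY acY]] := obstruction_pair XS obsX _ _ (arc_neq dy);
  rewrite ?inE ?dX ?yX //.
rewrite -cY; apply/subset_leq_card/subsetP=> x xY.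
have := Xd _ (YX _ xY); rewrite !inE (YX _ xY) => xd.
by apply: (acyclic_transitive acY (y := d)); rewrite // !inE ?eqxx ?xY ?orbT.
Qed.

Lemma obstruction_free_second_out u : k <= 2 -> u \in S ->
  obstruction_free T k
    (S :&: in_nbhd T u :&: reach T (S :&: out_nbhd T u)).
Proof.
move=> k2 uS X; rewrite !subsetI => /andP[/andP[XS Xu] Xreach].
apply/negP=> obsX.
have [D minD] := minset_exists (P := fun D => X \subset reach T D) Xreach.
rewrite subsetI => /andP[DS uD].
have [/andP[/eqP cX _] [covD _]] := (obsX, minsetP minD).
have cover_le d : d \in D -> #|X :&: out_nbhd T d| <= k.
  move=> dD; apply: leq_card_out; first by rewrite cX.
  apply: (obstruction_card_in XS obsX Xu uS (subsetP DS d dD)).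
  by move/subsetP/(_ d dD): uD; rewrite inE.
have cD : k < #|D|.
  rewrite ltnNge; apply/negP=> cD; have := leq_card_reach covD cover_le.
  by rewrite cX -mul2n ltnNge leq_mul // (leq_trans cD).
have [D' D'D cD'] := subset_of_card cD.
have [g gX matchD] := minimal_reach_matching uD Xu minD.
have := induced_matching_obstruction (induced_matchingS D'D matchD).
apply/negP; rewrite cD'; apply: freeS.
rewrite !subUset sub1set uS (subset_trans D'D DS).
by apply/subsetP=> _ /imsetP[d /(subsetP D'D)/gX/(subsetP XS)? ->].
Qed.

End Descent.

Lemma obstruction_free_second_in (V : finType) (T : tournament V) k S u :
  obstruction_free T k.+1 S -> k <= 2 -> u \in S ->
  obstruction_free T k
    (S :&: out_nbhd T u :&: reach (converse T) (S :&: in_nbhd T u)).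
Proof.
move=> /obstruction_free_converse freeS k2 uS X XE.
rewrite -obstruction_converse.
exact: (obstruction_free_second_out freeS k2 uS).
Qed.

Lemma obstruction_free_between_path (V : finType) (T : tournament V) k S d y v :
  obstruction_free T k.+1 S -> d \in S -> y \in S -> v \in S ->
  T d y -> T y v ->
  obstruction_free T k (S :&: in_nbhd T d :&: out_nbhd T v).
Proof.
move=> freeS dS yS vS dy yv X.
rewrite !subsetI => /andP[/andP[XS Xd] vX]; apply/negP=> obsX.
have cIn := obstruction_card_in freeS XS obsX Xd dS yS dy.
have freeS' := obstruction_free_converse freeS.
have : k < #|X :&: out_nbhd T y|.
  apply: (obstruction_card_in freeS' XS _ vX vS yS yv).
  by rewrite obstruction_converse.
by case/andP: obsX => /eqP cX _; rewrite ltnNge leq_card_out ?cX.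
Qed.

(** * Splitting a 3-obstruction-free tournament into three parts *)

Section Labels.
Variables (V : finType) (T : tournament V).
Implicit Types (f : V -> nat) (A : {set V}) (x y : V) (p q i : nat).

Definition level f i := [set x | f x == i].

(* The labels 0 and 1 mark the vertices that are not yet placed. *)
Definition unplaced f := [set x | f x <= 1].

Lemma unplaced_level f : unplaced f = level f 0 :|: level f 1.
Proof. by apply/setP=> x; rewrite !inE; case: (f x) => [|[|?]]. Qed.

Definition spread f p q y :=
  if y \in unplaced f :&: reach T (level f p) then q else f y.

Lemma spreadE f p q A : A \subset level f p ->
  {in unplaced f & level f p, forall y x, x \notin A -> T y x} ->
  spread f p q =1 fun y => if y \in unplaced f :&: reach T A then q else f y.
Proof.
move=> sA old y; rewrite /spread !in_setI.
case: (boolP (y \in unplaced f)) => //= yU.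
suff -> : (y \in reach T (level f p)) = (y \in reach T A) by [].
apply/idP/idP=> [/reachP[x xp xy]|]; last exact/subsetP/reachS.
apply/reachP; exists x => //; apply/negPn/negP=> /(old y x yU xp).
exact: arc_asym.
Qed.

Lemma spread_idle f p q :
  level (spread f p q) q = set0 -> spread f p q =1 f.
Proof.
move=> noq y; have := in_set0 y; rewrite -noq inE /spread.
by case: ifP; rewrite ?eqxx.
Qed.

Lemma level_spread_idle f p q i :
  level (spread f p q) q = set0 -> level (spread f p q) i = level f i.
Proof. by move/spread_idle=> idle; apply/setP=> x; rewrite !inE idle. Qed.

End Labels.

Section Round.
Variables (V : finType) (T : tournament V).
Hypothesis freeT : obstruction_free T 3 setT.
Implicit Types (f g : V -> nat) (x y d v : V) (j p q c : nat).

Definition part f c := [set x | (1 < f x) && (f x %% 3 == c)].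

(* Label 1 marks the frontier, 2 the pivots, 5 their out-neighbours, and j,
   which alternates between 3 and 4, the vertices at distance two from the pivot
   of the coming round.  Placed vertices with the same label modulo 3 form a
   part. *)
Record split_invariant j f := SplitInvariant {
  split_code : j \in [:: 3; 4];
  split_arc : {in unplaced f & ~: unplaced f,
    forall x y, T y x -> f x = 1 /\ f y = 7 - j};
  split_frontier : {in level f 1, forall x,
    exists d y, [/\ T d y, T y x & unplaced f \subset in_nbhd T d]};
  split_part : forall c, obstruction_free T 2 (part f c) }.

Definition pivot f v :=
  if level f 1 == set0 then min_outdegree T (level f 0) v
  else min_outdegree (converse T) (level f 1) v.

Definition split_step j f v :=
  spread T (spread T (spread T [eta f with v |-> 2] 2 5) 5 j) j 1.

Lemma split_init : split_invariant 3 (fun=> 0).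
Proof.
split=> // [x y|x|c]; rewrite ?inE //; apply: obstruction_free_small.
by rewrite (_ : part _ _ = set0) ?cards0 //; apply/setP=> x; rewrite !inE.
Qed.

Variables (j : nat) (f : V -> nat) (v : V).
Hypotheses (inv : split_invariant j f) (pv : pivot f v).

Let U := unplaced f.
Let N := U :&: out_nbhd T v.
Let J := U :&: in_nbhd T v :&: reach T N.
Let R := (U :&: in_nbhd T v) :\: reach T N.

Let f' := split_step j f v.

Let jP : j = 3 \/ j = 4.
Proof.
by have := split_code inv; rewrite !inE => /orP[]/eqP; [left | right].
Qed.

Let RU : R \subset U :&: in_nbhd T v.
Proof. exact: subsetDl. Qed.

Lemma pivot_unplaced : v \in U.
Proof.
by move: pv; rewrite /pivot; case: ifP => _ [+ _]; rewrite !inE => /eqP->.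
Qed.

Lemma arc_unplaced_old x y :
  x \in U -> 1 < f y -> f y != 7 - j -> T x y.
Proof.
move=> xU fy nj; apply: arcN; last first.
  apply: contraNN nj => yx.
  by have [|_ ->] := split_arc inv xU _ yx; rewrite // !inE -ltnNge.
by apply: contraTneq xU => <-; rewrite inE -ltnNge.
Qed.

Lemma out_pivot_free : obstruction_free T 2 N.
Proof.
have NU : N \subset setT :&: out_nbhd T v by rewrite setTI subsetIr.
move: pv; rewrite /pivot; case: eqVneq => [F0|_] [vU vmin].
  have U0 : U = level f 0 by rewrite /U unplaced_level F0 setU0.
  have := obstruction_free_second_in freeT isT (in_setT v).
  apply: obstruction_freeS; rewrite subsetI NU /N U0.
  apply: subset_trans (min_outdegree_second (conj vU vmin)) (reachS _ _).
  exact/setSI/subsetT.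
have [d [y [dy yv Ud]]] := split_frontier inv vU.
have := obstruction_free_between_path freeT
  (in_setT d) (in_setT y) (in_setT v) dy yv.
by apply: obstruction_freeS; rewrite setTI setSI.
Qed.

Lemma second_pivot_free : obstruction_free T 2 J.
Proof.
have := obstruction_free_second_out freeT isT (in_setT v).
apply: obstruction_freeS; rewrite setISS ?setSI ?subsetT //.
by rewrite reachS // setSI ?subsetT.
Qed.

Lemma rest_label0 x : x \in R -> f x = 0.
Proof.
rewrite !inE -/N => /and3P[xreach xU xv]; move: pv; rewrite /pivot.
case: eqVneq => [/setP/(_ x)|_ vking].
  by rewrite !inE; case: (f x) xU => [|[|?]].
case fx: (f x) xU => [|[|?]] // _; case/negP: xreach.
have /subsetP/(_ x) := min_outdegree_second vking.
rewrite !inE fx /= xv => /(_ isT); apply/subsetP/reachS/subsetP=> y.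
by rewrite !inE /= => /andP[/eqP-> ->].
Qed.

Lemma unplacedE : U = v |: (N :|: (J :|: R)).
Proof.
have vU := pivot_unplaced; apply/setP=> x; rewrite !inE -/N.
have [->|xv] /= := eqVneq x v; first by rewrite inE in vU.
have := arc_orientation T xv.
by case: (f x <= 1); case: (T v x); case: (T x v); case: (x \in reach T N).
Qed.

Lemma split_spreadE (A : {set V}) g p q :
  p \in [:: 2; 5; j] -> A \subset level g p ->
  {in [predC A], forall x, g x = p -> f x = p} -> unplaced g \subset U ->
  spread T g p q =1 fun y => if y \in unplaced g :&: reach T A then q else g y.
Proof.
move=> pj sA old /subsetP gU; apply: spreadE => // y x /gU yU.
rewrite inE => /eqP gx xA; have fx := old x xA gx.
by apply: arc_unplaced_old => //; rewrite fx; case: jP pj => ->;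
   rewrite !inE => /or3P[]/eqP->.
Qed.

Lemma split_stepE : split_step j f v =1 fun y =>
  if y \in R :&: reach T J then 1 else if y \in J then j
  else if y \in N then 5 else if y == v then 2 else f y.
Proof.
have j1 : (j <= 1) = false by case: jP => ->.
pose f1 := [eta f with v |-> 2].
have U1 : unplaced f1 = U :\ v by apply/setP=> y; rewrite !inE /=; case: eqP.
pose f2 := spread T f1 2 5.
have f2E : f2 =1 fun y => if y \in N then 5 else f1 y.
  move=> y; rewrite /f2 (@split_spreadE [set v]) ?U1 ?subD1set //.
  - rewrite reach1 !inE; case: eqVneq => [->|//].
    by rewrite arc_irreflexive !andbF.
  - by rewrite sub1set inE /= eqxx.
  - by move=> x; rewrite !inE /= => /negPf->.
have U2 : unplaced f2 = U :&: in_nbhd T v.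
  apply/setP=> y; rewrite inE f2E !inE /=.
  case: eqVneq => [->|yv]; first by rewrite !arc_irreflexive !andbF.
  have := arc_orientation T yv.
  by case fy: (f y <= 1); case: (T y v); case: (T v y); rewrite /= ?fy.
pose f3 := spread T f2 5 j.
have f3E : f3 =1 fun y => if y \in J then j else f2 y.
  move=> y; rewrite /f3 (@split_spreadE N) ?U2 ?subsetIl //.
    by apply/subsetP=> x xN; rewrite inE f2E xN.
  by move=> x xN; rewrite f2E (negPf xN) /=; case: eqP => // ->.
have U3 : unplaced f3 = R.
  apply/setP=> y; rewrite inE f3E /R -U2 [RHS]in_setD [y \in J]in_setI -U2.
  by case: (boolP (y \in reach T N)); rewrite ?andbT ?andbF /= ?inE //;
    case: ifP => //; rewrite j1.
move=> y; rewrite /split_step -/f1 -/f2 -/f3.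
rewrite (@split_spreadE J) ?U3 ?f3E ?f2E //.
- by rewrite !inE eqxx !orbT.
- by apply/subsetP=> x xJ; rewrite inE f3E xJ.
- move=> x xJ; rewrite f3E (negPf xJ) f2E.
  by case: ifP => [_|_ /=]; [|case: eqP => // _]; case: jP => ->.
- by rewrite subDset setUC subsetU // subsetIl.
Qed.

Lemma split_step_old : {in ~: U, split_step j f v =1 f}.
Proof.
move=> y; rewrite split_stepE !inE => /negPf yU; rewrite yU /= !andbF /=.
by case: eqVneq yU pivot_unplaced => // ->; rewrite inE => ->.
Qed.

Lemma split_step_pivot : f' v = 2.
Proof. by rewrite /f' split_stepE !inE arc_irreflexive !andbF eqxx. Qed.

Lemma split_step_out : {in N, forall y, f' y = 5}.
Proof.
move=> y yN; have vy : T v y by move: yN; rewrite !inE => /andP[].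
have /negPf yv : ~~ T y v by apply/negP=> /(arc_asym vy).
by rewrite /f' split_stepE yN !inE yv !andbF.
Qed.

Lemma split_step_second : {in J, forall y, f' y = j}.
Proof.
move=> y yJ; rewrite /f' split_stepE yJ in_setI in_setD.
by move: yJ; rewrite inE => /andP[_ ->].
Qed.

Lemma split_step_rest : {in R, forall y, f' y = (y \in reach T J)}.
Proof.
move=> y yR; rewrite /f' split_stepE in_setI yR /=.
case: ifP => // _; rewrite rest_label0 //.
move: yR; rewrite !inE -/N => /and3P[/negPf-> _ yv]; rewrite andbF.
have /negPf-> : ~~ T v y by apply/negP=> /(arc_asym yv).
by rewrite andbF (negPf (arc_neq yv)).
Qed.

Lemma unplaced_split_step : unplaced f' = R.
Proof.
apply/setP=> y; rewrite inE; have [yR|yR] := boolP (y \in R).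
  by rewrite split_step_rest // leq_b1.
apply/negP=> f'y; have [yU|yU] := boolP (y \in U); last first.
  by case/negP: (yU); rewrite inE -split_step_old ?in_setC.
move: yU f'y; rewrite unplacedE in_setU1 !in_setU (negPf yR) orbF.
case/or3P=> [/eqP->|/split_step_out->|/split_step_second->] //.
  by rewrite split_step_pivot.
by case: jP => ->.
Qed.

Let added_part c := if c == 2 then v |: N else if c == j %% 3 then J else set0.

Lemma part_split_step c : part f' c \subset added_part c :|: part f c.
Proof.
apply/subsetP=> y; rewrite inE => /andP[f'y]; rewrite in_setU.
have [yU|yU] := boolP (y \in U); last first.
  move: f'y; rewrite /f' split_step_old ?in_setC // => fy yc.
  by rewrite [y \in part f c]inE fy yc orbT.
rewrite /added_part; move: yU; rewrite unplacedE in_setU1 !in_setU.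
case/or4P=> [/eqP yv|yN|yJ|yR].
- by rewrite yv split_step_pivot eq_sym => ->; rewrite setU11.
- by rewrite split_step_out // eq_sym => ->; rewrite in_setU1 yN orbT.
- by rewrite split_step_second // eq_sym => /eqP->; case: jP yJ => -> /= ->.
- by rewrite -unplaced_split_step inE leqNgt f'y in yR.
Qed.

Lemma added_part_free c : obstruction_free T 2 (added_part c).
Proof.
rewrite /added_part; case: ifP => _.
  apply: obstruction_free2U; last exact: out_pivot_free.
    by move=> x y /set1P->; rewrite !inE => /andP[].
  by apply: obstruction_free_small; rewrite cards1.
case: ifP => _; first exact: second_pivot_free.
by apply: obstruction_free_small; rewrite cards0.
Qed.

Lemma added_part_dominates c : dominates T (added_part c) (part f c).
Proof.
have sU : added_part c \subset U.
  rewrite /added_part unplacedE; do 2?case: ifP => _; last exact: sub0set.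
    by rewrite setUS ?subsetUl.
  by rewrite setUA setUCA subsetUl.
move=> x y xc; rewrite inE => /andP[fy /eqP yc].
apply: arc_unplaced_old fy _; first exact: subsetP sU x xc.
apply: contraTneq xc => fy; rewrite /added_part -yc fy.
by case: jP => -> /=; rewrite inE.
Qed.

Lemma split_step_part c : obstruction_free T 2 (part f' c).
Proof.
apply: obstruction_freeS (part_split_step c) _.
apply: obstruction_free2U; last exact: split_part inv c.
  exact: added_part_dominates.
exact: added_part_free.
Qed.

Lemma split_step_invariant : split_invariant (7 - j) (split_step j f v).
Proof.
rewrite -/f'; have j77 : 7 - (7 - j) = j by case: jP => ->.
split; rewrite ?unplaced_split_step ?j77.
- by case: jP => ->.
- move=> x y xR; rewrite inE => yR yx; have /setIP[xU xv] := subsetP RU x xR.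
  have [yU|yU] := boolP (y \in U); last first.
    have [|fx _] := split_arc inv xU _ yx; first by rewrite inE.
    by have := rest_label0 xR; rewrite fx.
  move: yU; rewrite unplacedE in_setU1 !in_setU (negPf yR) orbF.
  case/or3P=> [/eqP yv|yN|yJ].
  + by rewrite inE -yv in xv; case: (arc_asym xv yx).
  + by move: xR; rewrite inE (arc_reach yN yx).
  + by rewrite split_step_rest // split_step_second // (arc_reach yJ yx).
- move=> x; rewrite inE => /eqP fx.
  have xR : x \in R by rewrite -unplaced_split_step inE fx.
  have /reachP[y yJ yx] : x \in reach T J.
    by move: fx; rewrite split_step_rest //; case: (x \in reach T J).
  have [_ /reachP[d dN dy]] := setIP yJ; exists d, y; split=> //.
  apply/subsetP=> z; rewrite in_setD => /andP[zN /setIP[_ zv]].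
  rewrite inE (arc_unreached dN zN) //; apply: contraTneq dN => ->.
  rewrite !inE in zv *; rewrite negb_and; apply/orP; right.
  by apply/negP=> /(arc_asym zv).
- exact: split_step_part.
Qed.

Lemma unplaced_split_step_proper :
  unplaced (split_step j f v) \proper unplaced f.
Proof.
rewrite -/f' unplaced_split_step; apply/properP; split.
  by rewrite subDset setUC subsetU // subsetIl.
by exists v; rewrite ?pivot_unplaced // !inE arc_irreflexive !andbF.
Qed.

End Round.

(** * Distance layers of a 2-obstruction-free set *)

Section NextLayer.
Variables (V : finType) (T : tournament V) (C : {set V}).
Hypothesis freeC : obstruction_free T 2 C.
Implicit Types (A L W : {set V}) (x y z p q u : V).

Definition cyclic_triple x y z := ~~ acyclic T [set x; y; z].

Lemma cyclic_tripleI x y z : T x y -> T y z -> T z x -> cyclic_triple x y z.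
Proof.
move=> xy yz zx; apply/negP=> /acyclicP/(_ x y z); apply;
  by rewrite // !inE eqxx ?orbT.
Qed.

Lemma cyclic_triple_uniq x y z :
  cyclic_triple x y z -> [/\ x != y, x != z & y != z].
Proof.
move=> cyc; apply/and3P; rewrite -card_set3_gt2 ltnNge.
by apply: contraNN cyc; apply: acyclic_card_le2.
Qed.

(* In a 2-obstruction-free set some vertex meets every triangle on five given
   vertices, but these three triangles have no common vertex. *)
Lemma no_three_cyclic_triples a b c d e :
  [set a; b; c; d; e] \subset C -> c != d -> c != e ->
  cyclic_triple a b c -> cyclic_triple a d e -> cyclic_triple b d e -> False.
Proof.
set U := [set a; b; c; d; e] => UC cd ce abc ade bde.
have [ab ac bc] := cyclic_triple_uniq abc.
have [[ad ae de] [bd be _]] := (cyclic_triple_uniq ade, cyclic_triple_uniq bde).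
have sU : U =i [:: a; b; c; d; e] by move=> x; rewrite !inE -!orbA.
have cU : #|U| = 5.
  rewrite (eq_card sU); apply/card_uniqP.
  by rewrite /= !inE !negb_or ab ac ad ae bc bd be cd ce de.
move/obstruction_freeP/(_ _ UC cU)/has_acyclicP: freeC => [Y [YU cY acY]].
have /cards1P[v vE] : #|U :\: Y| == 1 by rewrite cardsD (setIidPr YU) cU cY.
have meets x y z : [set x; y; z] \subset U -> cyclic_triple x y z ->
    v \in [:: x; y; z].
  move=> sub; apply: contraNT => vxyz; apply: acyclicS acY.
  apply/subsetP=> t txyz; apply: contraNT vxyz => tY.
  have /set1P <- : t \in [set v] by rewrite -vE inE tY (subsetP sub).
  by rewrite !inE orbA in txyz *.
have [] := (meets a b c, meets a d e, meets b d e).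
have vin x : x \in [:: a; b; c; d; e] -> x \in U by rewrite sU.
rewrite !subUset !sub1set !vin ?inE ?eqxx ?orbT //.
move=> [/(_ isT abc) vabc /(_ isT ade) vade] /(_ isT bde).
case/or3P: vabc vade => /eqP->.
- by rewrite (negPf ab) (negPf ad) (negPf ae).
- by rewrite eq_sym (negPf ab) (negPf bd) (negPf be).
- by rewrite eq_sym (negPf ac) (negPf cd) (negPf ce).
Qed.

Definition triangle_free2 A W :=
  {in A & A & W, forall x y z, T x y -> T y z -> T z x -> False}.

(* A is the last layer and W the set of the vertices beyond it; in the third
   case q is a vertex of the layer before A. *)
Definition top_layer A W :=
  [\/ dominates T W A,
      exists2 u, A = [set u] & min_outdegree T (u |: W) u
    | exists q, [/\ q \in C, {in A, forall x, T q x}, {in W, forall x, T x q} &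
                    triangle_free2 A W]].

Record next_layer A L W := NextLayer {
  next_layer_acyclic : acyclic T L;
  next_layer_new_new_old : triangle_free2 L A;
  next_layer_old_old_new : triangle_free2 A L;
  next_layer_top : top_layer L W }.

Lemma next_layer_root A W u : u \in W -> dominates T W A ->
  min_outdegree T W u -> next_layer A [set u] (W :\ u).
Proof.
move=> uW domWA umin; split.
- by rewrite acyclic_card_le2 ?cards1.
- by move=> x y z /set1P-> /set1P->; rewrite arc_irreflexive.
- move=> x y z xA yA /set1P-> _ yu _.
  exact: arc_asym yu (domWA u y uW yA).
- by constructor 2; exists u; rewrite ?setD1K.
Qed.

Variables (A W : {set V}).
Hypotheses (AC : A \subset C) (WC : W \subset C) (disjAW : [disjoint A & W]).

Let L := W :&: reach T A.
Let W' := W :\: reach T A.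

Let LC : L \subset C. Proof. exact: subset_trans (subsetIl _ _) WC. Qed.
Let W'C : W' \subset C. Proof. exact: subset_trans (subsetDl _ _) WC. Qed.

Lemma rest_dominates : dominates T W' A.
Proof.
move=> x y; rewrite inE => /andP[xA xW] yA; apply: arc_unreached (yA) xA _.
by apply: contraTneq yA => ->; rewrite (disjointFl disjAW).
Qed.

Section FromRoot.
Variable u : V.
Hypotheses (Au : A = [set u]) (umin : min_outdegree T (u |: W) u).

Let uC : u \in C. Proof. by rewrite -sub1set -Au. Qed.

Let uL : {in L, forall x, T u x}.
Proof. by move=> x; rewrite inE Au reach1 inE => /andP[]. Qed.

Let W'u : {in W', forall x, T x u}.
Proof. by move=> x xW'; apply: rest_dominates; rewrite // Au set11. Qed.

Lemma root_out_returns :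
  {in L, forall x, exists d, [/\ d \in W, T x d & T d u]}.
Proof.
move=> x xL; have /subsetP/(_ x) := min_outdegree_second umin.
have xW : x \in W by case/setIP: xL.
rewrite !inE xW orbT (uL xL) => /(_ isT)/reachP[d] /[!inE] /andP[duW du] xd.
by exists d; split=> //; move: duW; rewrite (negPf (arc_neq du)).
Qed.

Lemma next_layer_from_root : next_layer A L W'.
Proof.
split.
- apply: obstruction_free1_acyclic.
  apply: obstruction_freeS (obstruction_free_second_in freeC _ uC) => //.
  apply/subsetP=> x xL; rewrite !inE (subsetP LC) // uL //=.
  have [d [dW xd du]] := root_out_returns xL.
  by apply: (@arc_reach _ _ _ d); rewrite // !inE (subsetP WC d dW).
- by move=> x y z _ yL; rewrite Au => /set1P-> _ /(arc_asym (uL yL)).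
- by move=> x y z; rewrite Au => /set1P-> /set1P->; rewrite arc_irreflexive.
constructor 3; exists u; split=> // x y z xL yL zW' xy yz zx.
have zu := W'u zW'.
have [d [dW xd du]] := root_out_returns xL.
apply: (@no_three_cyclic_triples u x d y z).
- rewrite !subUset !sub1set uC (subsetP LC x xL) (subsetP LC y yL).
  by rewrite (subsetP WC d dW) (subsetP W'C z zW').
- by apply: contraTneq du => ->; apply/negP=> /(arc_asym (uL yL)).
- by apply: contraTneq xd => ->; apply/negP=> /(arc_asym zx).
- exact: cyclic_tripleI (uL xL) xd du.
- exact: cyclic_tripleI (uL yL) yz zu.
- exact: cyclic_tripleI xy yz zx.
Qed.

End FromRoot.

Section FromDominator.
Variable q : V.
Hypotheses (qC : q \in C) (qA : {in A, forall x, T q x}).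
Hypotheses (Wq : {in W, forall x, T x q}) (triAW : triangle_free2 A W).

(* Otherwise q would have an induced matching of two arcs from A to L. *)
Lemma dominator_exists : L != set0 ->
  exists2 p, p \in A & {in L, forall y, T p y}.
Proof.
case/set0Pn=> y0 /setIP[_ /reachP[p0 p0A _]].
have [p pA pmax] := arg_maxnP (fun p => #|L :&: out_nbhd T p|) p0A.
exists p => // y yL; apply: contraT => npy.
have /setIP[yW /reachP[p' p'A p'y]] := yL.
have : ~~ (L :&: out_nbhd T p \subset L :&: out_nbhd T p').
  apply: contraTN (pmax p' p'A) => sub; rewrite -ltnNge; apply: proper_card.
  apply/properP; split=> //; exists y;
    by rewrite !inE -?in_setI yL ?p'y ?(negPf npy).
case/subsetPn=> y' /setIP[y'L]; rewrite !inE -in_setI y'L => py' /= np'y'.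
have /setIP[y'W _] := y'L.
have back x z : x \in A -> z \in W -> ~~ T x z -> T z x.
  move=> xA zW; apply: arcN; apply: contraTneq zW => <-.
  by rewrite (disjointFr disjAW).
have p'p : p' != p by apply: contraNneq npy => <-.
pose g := [fun d => y with p |-> y'].
have gp : g p = y' by rewrite /= eqxx.
have gp' : g p' = y by rewrite /= (negPf p'p).
have matching : induced_matching T q [set p; p'] g.
  split=> [d /set2P[]->|d d' /set2P[]-> /set2P[]->]; rewrite ?gp ?gp' ?eqxx //.
  - by split; [apply: qA | | apply: Wq].
  - by split; [apply: qA | | apply: Wq].
  - by move=> _; apply: back np'y'.
  - by move=> _; apply: back npy.
have obs : obstruction T 2 (matching_set q [set p; p'] g).
  by have := induced_matching_obstruction matching; rewrite cards2 eq_sym p'p.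
suff /freeC : matching_set q [set p; p'] g \subset C by rewrite obs.
rewrite /matching_set imsetU1 imset_set1 gp gp' !subUset !sub1set qC.
rewrite (subsetP AC p pA) (subsetP AC p' p'A).
by rewrite (subsetP WC y' y'W) (subsetP WC y yW).
Qed.

Lemma next_layer_from_dominator : L != set0 -> next_layer A L W'.
Proof.
case/dominator_exists=> p pA pL; have LW x : x \in L -> x \in W by case/setIP.
have qp := qA pA; have pC := subsetP AC p pA.
split=> //.
- apply: obstruction_free1_acyclic.
  apply: obstruction_freeS (obstruction_free_between_arc freeC qC pC qp).
  by apply/subsetP=> x xL; rewrite !inE (subsetP LC) // Wq ?LW ?pL.
- move=> x y z xL yL zA xy yz zx.
  apply: (@no_three_cyclic_triples q y p z x).
  + rewrite !subUset !sub1set qC pC (subsetP LC y yL) (subsetP LC x xL).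
    by rewrite (subsetP AC z zA).
  + by apply: contraTneq (pL y yL) => ->; apply/negP=> /(arc_asym yz).
  + by apply: contraTneq pA => ->; rewrite (disjointFl disjAW) ?LW.
  + rewrite /cyclic_triple setUAC.
    exact: cyclic_tripleI qp (pL y yL) (Wq (LW y yL)).
  + exact: cyclic_tripleI (qA zA) zx (Wq (LW x xL)).
  + exact: cyclic_tripleI yz zx xy.
- by move=> x y z xA yA /LW; apply: triAW.
- constructor 3; exists p; split=> // [x xW'|]; first exact: rest_dominates.
  move=> x y z xL yL zW' xy yz zx; have zp := rest_dominates zW' pA.
  have zW : z \in W by case/setDP: zW'.
  apply: (@no_three_cyclic_triples p x q y z).
  + rewrite !subUset !sub1set qC pC (subsetP LC y yL) (subsetP LC x xL).
    by rewrite (subsetP WC z zW).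
  + by apply: contraTneq (Wq (LW y yL)) => ->; rewrite arc_irreflexive.
  + by apply: contraTneq (Wq zW) => ->; rewrite arc_irreflexive.
  + exact: cyclic_tripleI (pL x xL) (Wq (LW x xL)) qp.
  + exact: cyclic_tripleI (pL y yL) yz zp.
  + exact: cyclic_tripleI xy yz zx.
Qed.

End FromDominator.

Lemma next_layer_reach : top_layer A W -> L != set0 -> next_layer A L W'.
Proof.
move=> topA L0; case: topA => [domWA|[u Au umin]|[q [qC qA Wq triAW]]].
- case/set0Pn: L0 => y; rewrite inE => /andP[yW /reachP[x xA xy]].
  by case: (arc_asym xy (domWA y x yW xA)).
- exact: next_layer_from_root Au umin.
- exact: (next_layer_from_dominator qC).
Qed.

End NextLayer.

Section Layering.
Variables (V : finType) (T : tournament V) (C : {set V}).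
Hypothesis freeC : obstruction_free T 2 C.
Implicit Types (B : V -> nat) (L : {set V}) (x y z u : V) (t r : nat).

Definition height t B x := if B x == 0 then t else B x.

(* Label 2 marks the vertices outside C, label 0 those not yet placed, and the
   layers are numbered from 4 on. *)
Record layering t B := Layering {
  layering_start : 4 <= t;
  layering_out : forall x, (B x == 2) = (x \notin C);
  layering_code : {in C, forall x, (B x == 0) || (4 <= B x < t)};
  layering_gap :
    {in C &, forall x y, (height t B x).+1 < height t B y -> T y x};
  layering_triangle : {in C :\: level B 0 & &, forall x y z,
    T x y -> T y z -> T z x -> B x != B y};
  layering_top : top_layer T C (level B t.-1) (level B 0) }.

Lemma layering_init : layering 4 (fun x => if x \in C then 0 else 2).
Proof.
split=> // [x|x ->|x y xC yC|x y z|] //.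
- by case: (x \in C).
- by rewrite /height xC yC.
- by rewrite !inE; case: (x \in C).
- by constructor 1=> x y _; rewrite inE; case: (y \in C).
Qed.

Lemma layering_acyclic t B r : layering t B -> level B 0 = set0 -> r < 3 ->
  acyclic T [set x in C | B x %% 3 != r].
Proof.
move=> lay B0 r3; have placed x : x \in C -> x \in C :\: level B 0.
  by rewrite B0 setD0.
have h x : height t B x = B x.
  by have := in_set0 x; rewrite -B0 /height inE => ->.
have arc_height x y : x \in C -> y \in C -> T x y -> B y <= (B x).+1.
  move=> xC yC xy; rewrite leqNgt; apply/negP=> gap.
  by apply: (arc_asym xy); apply: (layering_gap lay); rewrite ?h.
apply/acyclicP=> x y z; rewrite !inE.
move=> /andP[xC xr] /andP[yC yr] /andP[zC zr] xy yz zx.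
have [[xP yP] zP] := (placed x xC, placed y yC, placed z zC).
have := (layering_triangle lay xP yP zP xy yz zx,
  layering_triangle lay yP zP xP yz zx xy,
  layering_triangle lay zP xP yP zx xy yz).
have := (arc_height x y xC yC xy, arc_height y z yC zC yz,
  arc_height z x zC xC zx).
move: (B x) (B y) (B z) xr yr zr => a b c.
by clear -r3 => ar br cr [[ab bc] ca] [[nab nbc] nca]; lia.
Qed.

Section Extend.
Variables (t : nat) (B : V -> nat).
Hypothesis lay : layering t B.

Let A := level B t.-1.
Let W := level B 0.

Let t4 : 4 <= t. Proof. exact: layering_start lay. Qed.

Lemma unplaced_layering : unplaced B = W.
Proof.
apply/setP=> x; rewrite !inE; have [xC|xC] := boolP (x \in C).
  have /orP[/eqP->//|/andP[Bx _]] := layering_code lay xC.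
  by rewrite leqNgt eqn0Ngt (leq_trans _ Bx) ?(leq_trans _ Bx).
by have := layering_out lay x; rewrite xC => /eqP->.
Qed.

Lemma layering_levelS i : i != 2 -> level B i \subset C.
Proof.
move=> i2; apply/subsetP=> x; rewrite inE => /eqP Bx.
by rewrite -[_ \in _]negbK -(layering_out lay) Bx.
Qed.

Lemma layering_disjoint : [disjoint A & W].
Proof.
rewrite -setI_eq0; apply/set0Pn=> -[x]; rewrite !inE => /andP[/eqP-> /eqP t1].
by have := t4; rewrite -(ltn_predK t4) t1.
Qed.

Variables (L : {set V}) (B' : V -> nat).
Hypotheses (LW : L \subset W) (next : next_layer T C A L (W :\: L)).
Hypothesis domWA : dominates T (W :\: L) A.
Hypothesis B'E : forall x, B' x = if x \in L then t else B x.

Lemma height_extend x :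
  height t.+1 B' x = if x \in W :\: L then t.+1 else height t B x.
Proof.
rewrite /height B'E in_setD [x \in W]inE.
have [xL|xL] /= := boolP (x \in L); last by case: (B x == 0).
move/(subsetP LW): xL; rewrite inE => ->.
by rewrite gtn_eqF // (leq_trans _ t4).
Qed.

Lemma layering_extend_gap : {in C &, forall x y,
  (height t.+1 B' x).+1 < height t.+1 B' y -> T y x}.
Proof.
move=> x y xC yC; rewrite !height_extend; case: ifP => [_|xW].
  case: ifP => _; first by rewrite ltnNge leqnSn.
  have yt : height t B y <= t.
    rewrite /height; case: eqP (layering_code lay yC) => //= _.
    by case/andP=> _ /ltnW.
  by move/leq_trans/(_ yt); rewrite ltnNge -addn2 leq_addr.
case: ifP => [yW|_]; last exact: (layering_gap lay).
rewrite !ltnS leq_eqVlt => /predU1P[hx|hx].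
  apply: domWA => //; move: hx; rewrite /height inE.
  by case: eqP => [_ [/eqP]|_ <-]; rewrite ?eqxx // eqn_leq ltnn.
apply: (layering_gap lay xC yC); move: yW; rewrite [height t B y]/height.
by rewrite in_setD => /andP[_]; rewrite inE => ->.
Qed.

Lemma layering_placed_lt x : x \in C -> x \notin W -> B x < t.
Proof.
by move=> /(layering_code lay); rewrite inE => /orP[->|/andP[_ ->]].
Qed.

Lemma unplaced_dominates x y :
  x \in W -> y \in C -> y \notin W -> y \notin A -> T x y.
Proof.
move=> xW yC yW yA; apply: (layering_gap lay) => //.
  exact: subsetP (layering_levelS _) x xW.
have yt := layering_placed_lt yC yW; move: xW yW yA; rewrite !inE /height.
move=> -> /negPf-> yA; rewrite ltn_neqAle yt andbT.
by apply: contraNneq yA => <-.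
Qed.

Lemma layering_extend_triangle : {in C :\: (W :\: L) & &, forall x y z,
  T x y -> T y z -> T z x -> B' x != B' y}.
Proof.
have old x : x \in C :\: (W :\: L) -> x \notin L -> x \in C :\: W.
  by rewrite !in_setD negb_and negbK => + /negPf xL; rewrite xL.
move=> x y z xP yP zP xy yz zx; rewrite !B'E.
have [xL|xL] := boolP (x \in L); have [yL|yL] := boolP (y \in L).
- have [zL|/(old z zP)/setDP[zC zW]] := boolP (z \in L).
    by case: (acyclicP _ _ (next_layer_acyclic next) x y z).
  have [zA|zA] := boolP (z \in A).
    by case: (next_layer_new_new_old next xL yL zA).
  by case: (arc_asym zx (unplaced_dominates (subsetP LW x xL) zC zW zA)).
- have /setDP[yC yW] := old y yP yL.
  by rewrite gtn_eqF ?layering_placed_lt.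
- have /setDP[xC xW] := old x xP xL.
  by rewrite ltn_eqF ?layering_placed_lt.
have [xO yO] := (old x xP xL, old y yP yL).
have [zL|zL] := boolP (z \in L); last first.
  exact: (layering_triangle lay xO yO (old z zP zL)).
have [/setDP[yC yW] zW] := (yO, subsetP LW z zL).
apply/eqP=> Bxy; have [yA|yA] := boolP (y \in A); last first.
  exact: arc_asym yz (unplaced_dominates zW yC yW yA).
have xA : x \in A by move: yA; rewrite !inE Bxy.
exact: (next_layer_old_old_new next xA yA zL).
Qed.

Lemma level_extend : level B' t = L.
Proof.
apply/setP=> x; rewrite inE B'E; case: ifP => [_|_]; first by rewrite eqxx.
apply/eqP=> Bx; have [xC|xC] := boolP (x \in C).
  have := layering_code lay xC; rewrite Bx ltnn andbF orbF.
  by rewrite eqn0Ngt (leq_trans _ t4).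
by have := layering_out lay x; rewrite xC Bx gtn_eqF // (leq_trans _ t4).
Qed.

Lemma level0_extend : level B' 0 = W :\: L.
Proof.
apply/setP=> x; rewrite !inE B'E; case: (x \in L) => //=.
by rewrite eqn0Ngt (leq_trans _ t4).
Qed.

Lemma layering_extend : layering t.+1 B'.
Proof.
split=> [|x|x xC|||]; rewrite ?level_extend ?level0_extend.
- exact: ltnW.
- rewrite B'E -(layering_out lay); case: ifP => // xL.
  rewrite gtn_eqF ?(leq_trans _ t4) //.
  by have := subsetP LW x xL; rewrite inE => /eqP->.
- rewrite B'E; case: ifP => _; first by rewrite t4 ltnSn orbT.
  by case/orP: (layering_code lay xC) => [->|/andP[-> /leqW->]]; rewrite ?orbT.
- exact: layering_extend_gap.
- exact: layering_extend_triangle.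
- exact: next_layer_top next.
Qed.

Lemma unplaced_extend_proper : L != set0 -> unplaced B' \proper unplaced B.
Proof.
rewrite unplaced_layering => /set0Pn[x xL]; apply/properP; split.
  apply/subsetP=> y; rewrite inE B'E; case: ifP => _.
    by rewrite leqNgt (leq_trans _ t4).
  by rewrite -unplaced_layering inE.
exists x; first exact: subsetP xL.
by rewrite inE B'E xL -ltnNge (leq_trans _ t4).
Qed.

End Extend.

Section Step.
Variables (t : nat) (B : V -> nat).
Hypothesis lay : layering t B.

Let A := level B t.-1.
Let W := level B 0.
Let g := spread T B t.-1 t.

Let gE x : g x = if x \in W :&: reach T A then t else B x.
Proof. by rewrite /g /spread (unplaced_layering lay). Qed.

Let t4 : 4 <= t. Proof. exact: layering_start lay. Qed.

Let AC : A \subset C.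
Proof.
by apply: (layering_levelS lay); rewrite -eqSS (ltn_predK t4) gtn_eqF.
Qed.

Let WC : W \subset C. Proof. exact: (layering_levelS lay). Qed.

Let WD : W :\: (W :&: reach T A) = W :\: reach T A.
Proof. by rewrite setDIr setDv set0U. Qed.

Lemma layering_spread : level g t != set0 ->
  layering t.+1 g /\ unplaced g \proper unplaced B.
Proof.
have next : W :&: reach T A != set0 ->
    next_layer T C A (W :&: reach T A) (W :\: (W :&: reach T A)).
  rewrite WD; apply: next_layer_reach (layering_top lay) => //.
  exact: layering_disjoint.
have dom : dominates T (W :\: (W :&: reach T A)) A.
  by rewrite WD; apply: rest_dominates; apply: layering_disjoint.
rewrite (level_extend lay gE) => L0; split.
  exact: (layering_extend lay (subsetIl _ _) (next L0) dom gE).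
exact: (unplaced_extend_proper lay (subsetIl _ _) gE L0).
Qed.

Lemma layering_restart u : level g t = set0 -> min_outdegree T (level g 0) u ->
  layering t.+1 [eta g with u |-> t] /\
  unplaced [eta g with u |-> t] \proper unplaced B.
Proof.
move=> gt0; rewrite level_spread_idle // => umin; have [uW _] := umin.
have uE x : [eta g with u |-> t] x = if x \in [set u] then t else B x.
  by rewrite inE /= /g (spread_idle gt0).
have domWA : dominates T W A.
  have -> : W = W :\: reach T A.
    by rewrite -[LHS](setID _ (reach T A)) -(level_extend lay gE) gt0 set0U.
  exact: rest_dominates (layering_disjoint lay).
have sub : [set u] \subset W by rewrite sub1set.
split; last by apply: unplaced_extend_proper sub uE _ => //;
  apply/set0Pn; exists u; rewrite set11.
apply: (layering_extend lay sub _ _ uE); first exact: next_layer_root.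
by move=> x y /setD1P[_]; apply: domWA.
Qed.

End Step.
End Layering.

(** * Structured programs with bounded loops *)

Inductive prog :=
  | PSkip
  | PSet of nat & expr & expr
  | PSeq of prog & prog
  | PIf of expr & prog & prog
  | PFor of nat & expr & prog.

Definition scalar k := Get k (Const 0).

Definition for_guard k e := Bin Leq (Bin Add (scalar k) (Const 1)) e.

Definition for_next k := Bin Add (scalar k) (Const 1).

Fixpoint compile (p : prog) : cmd :=
  match p with
  | PSkip => Skip
  | PSet a i e => Set_ a i e
  | PSeq p q => Seq (compile p) (compile q)
  | PIf e p q => If e (compile p) (compile q)
  | PFor k e p =>
      Seq (Set_ k (Const 0) (Const 0))
          (While (for_guard k e)
             (Seq (compile p) (Set_ k (Const 0) (for_next k))))
  end.

Fixpoint writes (p : prog) : seq nat :=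
  match p with
  | PSkip => [::]
  | PSet a _ _ => [:: a]
  | PSeq p q | PIf _ p q => writes p ++ writes q
  | PFor k _ p => k :: writes p
  end.

(* Constants are charged their value, so that [eval m e < 2 ^ (b * expr_size e)]
   needs no bound on the constants of the program. *)
Fixpoint expr_size (e : expr) : nat :=
  match e with
  | Const n => n.+1
  | Get _ i => (expr_size i).+1
  | Bin _ e1 e2 => (expr_size e1 + expr_size e2).+1
  end.

Definition expr_bound b e := expr_size e * (b * expr_size e).+1.

Definition set_bound b i e := (expr_bound b i + expr_bound b e).+1.

(* Bounds the cost of a program that runs in cells of b bits and none of whose
   loops makes more than n rounds. *)
Fixpoint cost (b n : nat) (p : prog) : nat :=
  match p with
  | PSkip => 1
  | PSet _ i e => set_bound b i e
  | PSeq p q => (cost b n p + cost b n q).+1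
  | PIf e p q => (expr_bound b e + (cost b n p + cost b n q)).+1
  | PFor k e p =>
      let round := (expr_bound b (for_guard k e) +
        (cost b n p + set_bound b (Const 0) (for_next k)).+1).+1 in
      (set_bound b (Const 0) (Const 0) +
       (n * round + (expr_bound b (for_guard k e)).+1)).+1
  end.

Definition bounded b (m : memory) := forall a i, m a i < 2 ^ b.

Lemma eval_lt b m e : 0 < b -> bounded b m -> eval m e < 2 ^ (b * expr_size e).
Proof.
move=> b0 bm; elim: e => [n|a i _|o e1 IH1 e2 IH2] /=.
- by apply: leq_trans (ltn_expl n (isT : 1 < 2)) _; rewrite leq_exp2l //; nia.
- by apply: leq_trans (bm _ _) _; rewrite leq_exp2l // leq_pmulr.
move: (eval m e1) (eval m e2) IH1 IH2 => x y.
set p := b * expr_size e1; set q := b * expr_size e2 => xp yq.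
have -> : b * (expr_size e1 + expr_size e2).+1 = b + (p + q).
  by rewrite /p /q; lia.
apply: leq_trans (_ : 2 ^ (p + q).+1 <= _); last by rewrite leq_exp2l //; lia.
have [pq qp] : 2 ^ p <= 2 ^ (p + q) /\ 2 ^ q <= 2 ^ (p + q).
  by rewrite !leq_exp2l // leq_addr leq_addl.
have xy : x * y < 2 ^ (p + q) by rewrite expnD ltn_mul.
rewrite expnS; move: (2 ^ p) (2 ^ q) (2 ^ (p + q)) xp yq pq qp xy => P Q PQ *.
by case: o => /=; have := leq_div x y; lia.
Qed.

Lemma expr_cost_le b m e :
  0 < b -> bounded b m -> expr_cost m e <= expr_bound b e.
Proof.
move=> b0 bm; have bits_eval e' : bits (eval m e') <= b * expr_size e'.
  by apply: up_log_min => //; apply: eval_lt.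
rewrite /expr_bound; elim: e => [n|a i IH|o e1 IH1 e2 IH2].
- by have := bits_eval (Const n) => /=; nia.
- by have := bits_eval (Get a i) => /=; move: (bits _) (expr_cost m i) IH; nia.
have := bits_eval (Bin o e1 e2) => /=.
by move: (bits _) (expr_cost m e1) (expr_cost m e2) IH1 IH2; nia.
Qed.

Definition agree_off (s : seq nat) (m m' : memory) :=
  forall a i, a \notin s -> m' a i = m a i.

Lemma agree_off_trans s m1 m2 m3 :
  agree_off s m1 m2 -> agree_off s m2 m3 -> agree_off s m1 m3.
Proof. by move=> agr12 agr23 a i sa; rewrite agr23 ?agr12. Qed.

Lemma agree_offS s s' m m' :
  {subset s <= s'} -> agree_off s m m' -> agree_off s' m m'.
Proof.
by move=> sub agr a i sa; apply: agr; apply: contraNN sa; apply: sub.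
Qed.

Lemma agree_off_update s m a i v : a \in s -> agree_off s m (update m a i v).
Proof.
by move=> sa c j; rewrite /update; case: eqVneq => // ->; rewrite sa.
Qed.

Section TotalCorrectness.
Variables (b n r : nat) (input : memory).
Hypothesis b_gt0 : 0 < b.
Implicit Types (c : cmd) (p q : prog) (e : expr) (m : memory) (s : seq nat).
Implicit Types (a i j k t v : nat) (Q : memory -> Prop).

(* The arrays numbered below r hold the input and are never written. *)
Definition valid m :=
  bounded b m /\ forall a i, a < r -> m a i = input a i.

Definition runs c t s m Q := valid m ->
  exists m' t', [/\ exec c m m' t', t' <= t, valid m', agree_off s m m' & Q m'].

Definition wp p m Q := runs (compile p) (cost b n p) (writes p) m Q.

Lemma runs_valid c t s m Q : (valid m -> runs c t s m Q) -> runs c t s m Q.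
Proof. by move=> run vm; apply: run. Qed.

Lemma runs_weaken c t t' s s' m Q : t <= t' -> {subset s <= s'} ->
  runs c t s m Q -> runs c t' s' m Q.
Proof.
move=> tt' ss' run /run[m' [t0 [ex t0t vm' agr Qm']]].
by exists m', t0; split=> //; [apply: leq_trans tt' | apply: agree_offS agr].
Qed.

Lemma runs_conseq c t s m Q Q' : runs c t s m Q ->
  (forall m', valid m' -> agree_off s m m' -> Q m' -> Q' m') ->
  runs c t s m Q'.
Proof.
move=> run QQ' /run[m' [t' [ex t't vm' agr Qm']]].
by exists m', t'; split=> //; apply: QQ'.
Qed.

Lemma valid_update m a i v :
  valid m -> r <= a -> v < 2 ^ b -> valid (update m a i v).
Proof.
move=> [bm inm] ra vb; split=> [c j|c j cr]; rewrite /update; case: ifP => //.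
  by case/andP=> /eqP ca; rewrite ca ltnNge ra in cr.
by move=> _; apply: inm.
Qed.

Lemma runs_set a (i : expr) e m Q : r <= a -> eval m e < 2 ^ b ->
  Q (update m a (eval m i) (eval m e)) ->
  runs (Set_ a i e) (set_bound b i e) [:: a] m Q.
Proof.
move=> ra eb Qm vm; exists (update m a (eval m i) (eval m e)).
exists (expr_cost m i + expr_cost m e).+1; split=> //; first exact: ExecSet.
- by rewrite ltnS leq_add // expr_cost_le //; case: vm.
- exact: valid_update.
- by apply: agree_off_update; rewrite inE.
Qed.

Lemma runs_seq c1 c2 t1 t2 s m Q :
  runs c1 t1 s m (fun m' => runs c2 t2 s m' Q) ->
  runs (Seq c1 c2) (t1 + t2).+1 s m Q.
Proof.
move=> run1 /run1[m1 [t1' [ex1 le1 vm1 agr1 /(_ vm1)]]].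
move=> [m2 [t2' [ex2 le2 vm2 agr2 Qm2]]]; exists m2, (t1' + t2').+1; split=> //.
- exact: ExecSeq ex1 ex2.
- by rewrite ltnS leq_add.
- exact: agree_off_trans agr2.
Qed.

Lemma runs_while_true e c t1 t2 s m Q : eval m e != 0 ->
  runs c t1 s m (fun m' => runs (While e c) t2 s m' Q) ->
  runs (While e c) (expr_bound b e + t1 + t2).+1 s m Q.
Proof.
move=> e0 run1 vm; have [m1 [t1' [ex1 le1 vm1 agr1 /(_ vm1)]]] := run1 vm.
move=> [m2 [t2' [ex2 le2 vm2 agr2 Qm2]]].
exists m2, (expr_cost m e + t1' + t2').+1; split=> //.
- exact: ExecWhileTrue ex1 ex2.
- by rewrite ltnS !leq_add // expr_cost_le //; case: vm.
- exact: agree_off_trans agr2.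
Qed.

Lemma runs_while_false e c s m Q : eval m e = 0 -> Q m ->
  runs (While e c) (expr_bound b e).+1 s m Q.
Proof.
move=> e0 Qm vm; exists m, (expr_cost m e).+1; split=> //.
  exact: ExecWhileFalse.
by rewrite ltnS expr_cost_le //; case: vm.
Qed.

Lemma wp_skip m Q : Q m -> wp PSkip m Q.
Proof. by move=> Qm vm; exists m, 1; split=> //; constructor. Qed.

Lemma wp_set a (i : expr) e m Q : r <= a -> eval m e < 2 ^ b ->
  Q (update m a (eval m i) (eval m e)) -> wp (PSet a i e) m Q.
Proof. exact: runs_set. Qed.

Lemma wp_seq p q m P Q : wp p m P ->
  (forall m', valid m' -> agree_off (writes p) m m' -> P m' -> wp q m' Q) ->
  wp (PSeq p q) m Q.
Proof.
move=> wpp wpq; apply: runs_seq.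
have sub a : a \in writes p -> a \in writes (PSeq p q).
  by rewrite /= mem_cat => ->.
apply: runs_weaken (leqnn _) sub (runs_conseq wpp _) => m' vm' agr.
move/(wpq _ vm' agr); apply: runs_weaken => // a.
by rewrite /= mem_cat orbC => ->.
Qed.

Lemma wp_conseq p m Q Q' : wp p m Q ->
  (forall m', valid m' -> agree_off (writes p) m m' -> Q m' -> Q' m') ->
  wp p m Q'.
Proof. exact: runs_conseq. Qed.

Lemma wp_valid p m Q : (valid m -> wp p m Q) -> wp p m Q.
Proof. exact: runs_valid. Qed.

Lemma wp_if e p q m Q :
  (eval m e != 0 -> wp p m Q) -> (eval m e = 0 -> wp q m Q) ->
  wp (PIf e p q) m Q.
Proof.
move=> wp1 wp2 vm; have ce : expr_cost m e <= expr_bound b e.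
  by apply: expr_cost_le; case: vm.
have [e0|e0] := eqVneq (eval m e) 0.
  have [m' [t [ex le vm' agr Qm']]] := wp2 e0 vm.
  exists m', (expr_cost m e + t).+1; split=> //; first exact: ExecIfFalse.
    by rewrite /= ltnS leq_add // (leq_trans le) ?leq_addl.
  by apply: agree_offS agr => a; rewrite /= mem_cat orbC => ->.
have [m' [t [ex le vm' agr Qm']]] := wp1 e0 vm.
exists m', (expr_cost m e + t).+1; split=> //; first exact: ExecIfTrue.
  by rewrite /= ltnS leq_add // (leq_trans le) ?leq_addr.
by apply: agree_offS agr => a; rewrite /= mem_cat => ->.
Qed.

Section For.
Variables (k M : nat) (e : expr) (p : prog) (m : memory).
Variable I : nat -> memory -> Prop.
Hypotheses (rk : r <= k) (kp : k \notin writes p).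
Hypotheses (Mn : M <= n) (Mb : M < 2 ^ b).
Hypothesis eM :
  forall m', valid m' -> agree_off (k :: writes p) m m' -> eval m' e = M.
Hypothesis stepI : forall j m', j < M -> m' k 0 = j -> valid m' ->
  agree_off (k :: writes p) m m' -> I j m' ->
  wp p m' (fun m'' => I j.+1 (update m'' k 0 j.+1)).

Let round := (expr_bound b (for_guard k e) +
  (cost b n p + set_bound b (Const 0) (for_next k)).+1).+1.

Let sub_writes : {subset writes p <= k :: writes p}.
Proof. by move=> a; rewrite inE orbC => ->. Qed.

Let sub_counter : {subset [:: k] <= k :: writes p}.
Proof. by move=> a; rewrite inE => /eqP->; rewrite inE eqxx. Qed.

Lemma runs_for_loop d j m1 : d + j = M -> m1 k 0 = j ->
  agree_off (k :: writes p) m m1 -> I j m1 ->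
  runs (While (for_guard k e) (Seq (compile p) (Set_ k (Const 0) (for_next k))))
    (d * round + (expr_bound b (for_guard k e)).+1) (k :: writes p) m1 (I M).
Proof.
elim: d j m1 => [|d IHd] j m1 djM m1k agr1 Ij; apply: runs_valid => vm1.
  apply: runs_while_false; last by rewrite -djM.
  by rewrite /= m1k eM // -djM add0n addn1 ltnn.
have jM : j < M by rewrite -djM addSn ltnS leq_addl.
rewrite mulSn -addnA addSn; apply: runs_while_true.
  by rewrite /= m1k eM // addn1 jM.
apply: runs_seq; apply: (runs_weaken (leqnn _) sub_writes).
apply: runs_conseq (stepI jM m1k vm1 agr1 Ij) _ => m2 _ agr2 Ij1.
have m2k : m2 k 0 = j by rewrite agr2.
have next : eval m2 (for_next k) = j.+1 by rewrite /= m2k addn1.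
apply: (runs_weaken (leqnn _) sub_counter); apply: runs_set => //.
  by rewrite next (leq_ltn_trans jM Mb).
rewrite next; apply: (IHd j.+1) => //; first by rewrite addnS -addSn.
  by rewrite /update !eqxx.
apply: agree_off_trans agr1 _.
apply: agree_off_trans (agree_offS sub_writes agr2) _.
by apply: agree_off_update; rewrite inE eqxx.
Qed.

Lemma wp_for : I 0 (update m k 0 0) -> wp (PFor k e p) m (I M).
Proof.
move=> I0; apply: runs_seq.
apply: (runs_weaken (leqnn _) sub_counter).
apply: runs_set; rewrite ?expn_gt0 //.
have loop := runs_for_loop (addn0 M) _ _ I0.
apply: runs_weaken (_ : M * round + _ <= _) _ (loop _ _) => //.
- by rewrite leq_add2r leq_mul2r Mn orbT.
- by rewrite /update !eqxx.
- by apply: agree_off_update; rewrite inE eqxx.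
Qed.

End For.
End TotalCorrectness.

(** * The algorithm *)

Local Notation size_array := 0 (only parsing).
Local Notation arc_array := 1 (only parsing).
Local Notation numerator_array := 2 (only parsing).
Local Notation denominator_array := 3 (only parsing).
Local Notation output_array := 4 (only parsing).
Local Notation label_array := 5 (only parsing).
Local Notation part_array := 6 (only parsing).
Local Notation weight_array := 7 (only parsing).

(* The cells are the arrays of which only index 0 is used. *)
Local Notation inner_cell := 10 (only parsing).
Local Notation outer_cell := 11 (only parsing).
Local Notation round_cell := 12 (only parsing).
Local Notation count_cell := 13 (only parsing).
Local Notation choice_cell := 14 (only parsing).
Local Notation degree_cell := 15 (only parsing).
Local Notation next_cell := 16 (only parsing).
Local Notation part_cell := 17 (only parsing).
Local Notation residue_cell := 18 (only parsing).
Local Notation common_denominator_cell := 19 (only parsing).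
Local Notation candidate_cell := 20 (only parsing).
Local Notation best_cell := 21 (only parsing).

Local Notation "p ;; q" := (PSeq p q) (at level 90, right associativity).

Definition size_expr := scalar size_array.
Definition inner := scalar inner_cell.
Definition outer := scalar outer_cell.

Definition arc_expr i j := Get arc_array (Bin Add (Bin Mul size_expr i) j).

Definition fold_prog o init k e :=
  PSet k (Const 0) (Const init) ;;
  PFor inner_cell size_expr (PSet k (Const 0) (Bin o (scalar k) e)).

Definition sum_prog := fold_prog Add 0.

Definition map_prog a e := PFor inner_cell size_expr (PSet a inner e).

Definition spread_prog p q :=
  PFor outer_cell size_expr
    (sum_prog count_cell
       (Bin Mul (Bin Leq (Get label_array outer) (Const 1))
          (Bin Mul (Bin Eqn (Get label_array inner) p)
             (arc_expr inner outer))) ;;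
     PIf (scalar count_cell) (PSet label_array outer q) PSkip).

Definition select_body s arc :=
  sum_prog count_cell (Bin Mul (Bin Eqn (Get label_array inner) s) arc) ;;
  PIf (Bin Mul (Bin Eqn (Get label_array outer) s)
         (Bin Leq (Bin Add (scalar count_cell) (Const 1)) (scalar degree_cell)))
    (PSet choice_cell (Const 0) outer ;;
     PSet degree_cell (Const 0) (scalar count_cell))
    PSkip.

Definition select_prog s arc :=
  PSet degree_cell (Const 0) (Bin Add size_expr (Const 1)) ;;
  PFor outer_cell size_expr (select_body s arc).

Definition place_all_prog body :=
  PFor round_cell size_expr
    (sum_prog count_cell (Bin Leq (Get label_array inner) (Const 1)) ;;
     PIf (scalar count_cell) body PSkip).

Definition mod_expr e d := Bin Sub e (Bin Mul (Const d) (Bin Div e (Const d))).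

Definition pivot_prog :=
  sum_prog count_cell (Bin Eqn (Get label_array inner) (Const 1)) ;;
  PIf (scalar count_cell)
    (select_prog (Const 1) (arc_expr inner outer))
    (select_prog (Const 0) (arc_expr outer inner)).

Definition split_body :=
  pivot_prog ;;
  PSet label_array (scalar choice_cell) (Const 2) ;;
  spread_prog (Const 2) (Const 5) ;;
  spread_prog (Const 5) (scalar next_cell) ;;
  spread_prog (scalar next_cell) (Const 1) ;;
  PSet next_cell (Const 0) (Bin Sub (Const 7) (scalar next_cell)).

Definition split_prog :=
  map_prog label_array (Const 0) ;;
  PSet next_cell (Const 0) (Const 3) ;;
  place_all_prog split_body ;;
  map_prog part_array (mod_expr (Get label_array inner) 3).

Definition next_layer_prog :=
  spread_prog (Bin Sub (scalar next_cell) (Const 1)) (scalar next_cell) ;;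
  sum_prog count_cell (Bin Eqn (Get label_array inner) (scalar next_cell)) ;;
  PIf (scalar count_cell) PSkip
    (select_prog (Const 0) (arc_expr outer inner) ;;
     PSet label_array (scalar choice_cell) (scalar next_cell)).

Definition layer_body :=
  next_layer_prog ;;
  PSet next_cell (Const 0) (Bin Add (scalar next_cell) (Const 1)).

Definition layer_prog :=
  map_prog label_array (Bin Mul (Const 2)
    (Bin Sub (Const 1) (Bin Eqn (Get part_array inner) (scalar part_cell)))) ;;
  PSet next_cell (Const 0) (Const 4) ;;
  place_all_prog layer_body.

Definition weight_prog :=
  fold_prog Mul 1 common_denominator_cell (Get denominator_array inner) ;;
  map_prog weight_array (Bin Mul (Get numerator_array inner)
    (Bin Div (scalar common_denominator_cell) (Get denominator_array inner))).

Definition keep_expr :=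
  Bin Mul (Bin Eqn (Get part_array inner) (scalar part_cell))
    (Bin Sub (Const 1)
       (Bin Eqn (mod_expr (Get label_array inner) 3) (scalar residue_cell))).

Definition improve_prog :=
  sum_prog candidate_cell (Bin Mul keep_expr (Get weight_array inner)) ;;
  PIf (Bin Leq (scalar candidate_cell) (scalar best_cell)) PSkip
    (PSet best_cell (Const 0) (scalar candidate_cell) ;;
     map_prog output_array (Bin Sub (Const 1) keep_expr)).

Definition main_prog :=
  split_prog ;;
  weight_prog ;;
  PSet best_cell (Const 0) (Const 0) ;;
  map_prog output_array (Const 1) ;;
  PFor part_cell (Const 3)
    (layer_prog ;; PFor residue_cell (Const 3) improve_prog).

Section Rank.
Variable V : finType.

Definition rank (x : V) := index x (enum V).

Lemma rank_lt x : rank x < #|V|.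
Proof. by rewrite cardE index_mem mem_enum. Qed.

Lemma rank_inj : injective rank.
Proof. by move=> x y /index_inj-> //; rewrite mem_enum. Qed.

Lemma rank_surj i : i < #|V| -> exists x, rank x = i.
Proof.
rewrite cardE; case En: (enum V) => [//|x0 s] lt_i; exists (nth x0 (enum V) i).
by rewrite /rank index_uniq ?enum_uniq ?En.
Qed.

Lemma rank_ltS x y : (rank y < (rank x).+1) = (y == x) || (rank y < rank x).
Proof. by rewrite ltnS leq_eqVlt (inj_eq rank_inj). Qed.

Lemma big_rank_ltS (R : Type) (idx : R) (op : Monoid.com_law idx) x
    (F : V -> R) :
  \big[op/idx]_(y | rank y < (rank x).+1) F y =
  op (\big[op/idx]_(y | rank y < rank x) F y) (F x).
Proof.
rewrite (bigD1 x) /=; last by rewrite rank_ltS eqxx.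
rewrite Monoid.mulmC; congr (op _ _); apply: eq_bigl => y; rewrite rank_ltS.
by case: eqVneq => [->|_]; rewrite ?ltnn ?andbT.
Qed.

Lemma big_rank_lt_card (R : Type) (idx : R) (op : Monoid.law idx) (F : V -> R) :
  \big[op/idx]_(y | rank y < #|V|) F y = \big[op/idx]_y F y.
Proof. by apply: eq_bigl => y; rewrite rank_lt. Qed.

Definition stores a (m : memory) (f : V -> nat) := forall x, m a (rank x) = f x.

End Rank.

Record encodes (V : finType) (T : tournament V) (num den : V -> nat)
    (m : memory) : Prop := Encodes {
  encodes_card : m size_array 0 = #|V|;
  encodes_arc : forall x y, m arc_array (#|V| * rank x + rank y) = T x y;
  encodes_numerator : stores numerator_array m num;
  encodes_denominator : stores denominator_array m den }.

Section Algorithm.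
Variables (V : finType) (T : tournament V) (num den : V -> nat).
Variables (b n : nat) (input : memory).
Hypothesis inputE : encodes T num den input.
Hypotheses (b_gt0 : 0 < b) (Vn : #|V| + 3 <= n) (Vb : #|V| + 16 < 2 ^ b).
Implicit Types (f F : V -> nat) (m : memory) (e arc : expr) (x y : V).
Implicit Types (a k s : nat) (K : {set V}).

Local Notation valid := (valid b 4 input).
Local Notation wp := (wp b n 4 input).

Let cell_lt i : i <= #|V| + 16 -> i < 2 ^ b.
Proof. by move=> le_i; apply: leq_ltn_trans Vb. Qed.

Let const_lt i : i <= 16 -> i < 2 ^ b.
Proof. by move=> le_i; rewrite cell_lt // (leq_trans le_i) ?leq_addl. Qed.

Lemma valid_encodes m : valid m -> encodes T num den m.
Proof.
by move=> [_ inm]; split=> [|x y|x|x]; rewrite inm //; case: inputE.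
Qed.

Lemma eval_size m : valid m -> eval m size_expr = #|V|.
Proof. by case/valid_encodes. Qed.

Lemma eval_arc m i j x y : valid m -> eval m i = rank x -> eval m j = rank y ->
  eval m (arc_expr i j) = T x y.
Proof.
move=> vm ei ej; have [_ arcs _ _] := valid_encodes vm.
by rewrite -arcs -ei -ej -(eval_size vm).
Qed.

Lemma wp_for_vertices k p m (I : nat -> memory -> Prop) :
  3 < k -> k \notin writes p -> I 0 (update m k 0 0) ->
  (forall x m', m' k 0 = rank x -> valid m' -> agree_off (k :: writes p) m m' ->
     I (rank x) m' ->
     wp p m' (fun m'' => I (rank x).+1 (update m'' k 0 (rank x).+1))) ->
  wp (PFor k size_expr p) m (I #|V|).
Proof.
move=> k3 kp I0 step; apply: wp_for => //.
- by rewrite (leq_trans _ Vn) ?leq_addr.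
- by rewrite cell_lt ?leq_addr.
- by move=> m' vm' _; apply: eval_size.
- by move=> j m' /rank_surj[x <-]; apply: step.
Qed.

Lemma wp_fold o idx (op : Monoid.com_law idx) k e m F :
  eval_binop o =2 op -> 3 < k -> k != inner_cell ->
  (forall i, \big[op/idx]_(y | rank y < i) F y < 2 ^ b) ->
  (forall x m', m' inner_cell 0 = rank x -> valid m' ->
     agree_off [:: inner_cell; k] m m' -> eval m' e = F x) ->
  wp (fold_prog o idx k e) m (fun m' => m' k 0 = \big[op/idx]_x F x).
Proof.
move=> oE k3 ki bigb eE; have kupd m' j : update m' inner_cell 0 j k 0 = m' k 0.
  by rewrite /update (negPf ki).
apply: (wp_seq (P := fun m' => m' k 0 = idx)).
  by apply: wp_set; rewrite /= ?big_pred0 // /update ?eqxx //;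
    have := bigb 0; rewrite big_pred0.
move=> m1 _ agr1 m1k; rewrite -big_rank_lt_card.
pose I i m' := m' k 0 = \big[op/idx]_(y | rank y < i) F y.
apply: (wp_for_vertices (I := I)) => // [||x m' m'x vm' agr' Ix].
- by rewrite inE eq_sym.
- by rewrite /I kupd m1k big_pred0.
have val : eval m' (Bin o (scalar k) e) =
    \big[op/idx]_(y | rank y < (rank x).+1) F y.
  rewrite big_rank_ltS /= oE Ix (eE x) // => a i.
  rewrite !inE negb_or => /andP[ai ak]; rewrite agr' ?inE ?negb_or ?ai ?ak //.
  by rewrite agr1 ?inE.
by apply: wp_set => //; rewrite ?val ?bigb // /I kupd /update !eqxx.
Qed.

Lemma wp_sum k e m F : 3 < k -> k != inner_cell -> \sum_x F x < 2 ^ b ->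
  (forall x m', m' inner_cell 0 = rank x -> valid m' ->
     agree_off [:: inner_cell; k] m m' -> eval m' e = F x) ->
  wp (sum_prog k e) m (fun m' => m' k 0 = \sum_x F x).
Proof.
move=> k3 ki sumb eE; apply: wp_fold => // i; apply: leq_ltn_trans sumb.
by rewrite [leqRHS](bigID (fun y => rank y < i)) leq_addr.
Qed.

Lemma wp_count k e m (A : {set V}) : 3 < k -> k != inner_cell ->
  (forall x m', m' inner_cell 0 = rank x -> valid m' ->
     agree_off [:: inner_cell; k] m m' -> eval m' e = (x \in A)) ->
  wp (sum_prog k e) m (fun m' => m' k 0 = #|A|).
Proof.
move=> k3 ki eE; have cA : \sum_x (x \in A : nat) = #|A|.
  by rewrite -sum1_card [RHS]big_mkcond; apply: eq_bigr => x _; case: (x \in A).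
rewrite -cA; apply: wp_sum => //; rewrite cA.
by rewrite cell_lt // (leq_trans (max_card _)) ?leq_addr.
Qed.

Lemma wp_for_stores k a p m f F :
  3 < k -> k != a -> k \notin writes p -> stores a m f ->
  (forall x m', m' k 0 = rank x -> valid m' -> agree_off (k :: writes p) m m' ->
     (forall y, m' a (rank y) = if rank y < rank x then F y else f y) ->
     wp p m' (fun m'' => forall y,
       m'' a (rank y) = if y == x then F x else m' a (rank y))) ->
  wp (PFor k size_expr p) m (fun m' => stores a m' F).
Proof.
move=> k3 ka kp mf step.
pose I i m' := forall y, m' a (rank y) = if rank y < i then F y else f y.
have aupd m' j y : update m' k 0 j a (rank y) = m' a (rank y).
  by rewrite /update eq_sym (negPf ka).
have loop := @wp_for_vertices k p m I k3 kp.
apply: wp_conseq (loop _ _) _ => [y|x m' m'x vm' agr Ix|].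
- by rewrite aupd mf.
- apply: wp_conseq (step x m' m'x vm' agr Ix) _ => m'' _ _ post y.
  by rewrite aupd post rank_ltS Ix; case: eqVneq => [->|].
by move=> m' _ _ Im' y; rewrite Im' rank_lt.
Qed.

Lemma wp_map a e m F : 3 < a -> a != inner_cell -> (forall x, F x < 2 ^ b) ->
  (forall x m', m' inner_cell 0 = rank x -> valid m' ->
     agree_off [:: inner_cell; a] m m' -> eval m' e = F x) ->
  wp (map_prog a e) m (fun m' => stores a m' F).
Proof.
move=> a3 ai Fb eE.
apply: (@wp_for_stores _ _ _ _ (fun x => m a (rank x))) => //.
- by rewrite eq_sym.
- by rewrite inE eq_sym.
move=> x m' m'x vm' agr _; apply: wp_set => // [|y]; rewrite (eE x) //.
by rewrite /update eqxx /= m'x (inj_eq (@rank_inj V)).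
Qed.

Lemma spread_eq_source f p q x :
  1 < p -> p != q -> (spread T f p q x == p) = (f x == p).
Proof.
move=> p1 pq; rewrite /spread in_setI inE; case: ifP => // /andP[fx _].
by rewrite eq_sym (negPf pq) ltn_eqF // (leq_ltn_trans fx).
Qed.

Lemma wp_spread ep eq p q m f :
  stores label_array m f -> 1 < p -> p != q -> q < 2 ^ b ->
  (forall m', valid m' ->
     agree_off [:: label_array; inner_cell; outer_cell; count_cell] m m' ->
     eval m' ep = p /\ eval m' eq = q) ->
  wp (spread_prog ep eq) m
    (fun m' => stores label_array m' (spread T f p q)).
Proof.
move=> mf p1 pq qb epq; apply: wp_for_stores mf _ => // y m1 m1y vm1 agr1 lab1.
have {}epq m' : valid m' -> agree_off [:: inner_cell; count_cell] m1 m' ->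
    eval m' ep = p /\ eval m' eq = q.
  move=> vm' agr'; apply: epq => //.
  by apply: agree_off_trans (agree_offS _ agr1) (agree_offS _ agr'); apply/allP.
pose A := [set x | [&& f y <= 1, f x == p & T x y]].
have spreadA : spread T f p q y = if #|A| != 0 then q else f y.
  rewrite /spread in_setI inE cards_eq0; congr (if _ then _ else _).
  apply/andP/set0Pn=> [[fy /reachP[x]]|[x]]; rewrite inE.
    by move=> /eqP fx xy; exists x; rewrite inE fy fx eqxx.
  by case/and3P=> fy fx xy; split=> //; apply/reachP; exists x; rewrite ?inE.
apply: wp_seq.
  apply: (wp_count (A := A)) => // x m2 m2x vm2 agr2.
  have [epE _] := epq m2 vm2 agr2.
  have m2y : m2 outer_cell 0 = rank y by rewrite agr2.
  have /= -> := @eval_arc m2 inner outer x y vm2 m2x m2y.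
  rewrite m2x m2y epE !agr2 // !lab1 ltnn inE.
  have -> : ((if rank x < rank y then spread T f p q x else f x) == p) =
      (f x == p).
    by case: ifP => // _; apply: spread_eq_source.
  by case: (f y <= 1); case: (f x == p); case: (T x y).
move=> m2 vm2 agr2 m2A; have [|_ eqE] := epq m2 vm2.
  by apply: agree_offS agr2; apply/allP.
apply: wp_if; rewrite //= m2A => cA.
  have qE : eval m2 eq < 2 ^ b by rewrite eqE.
  apply: wp_set => // z; rewrite /update /= agr2 // m1y (inj_eq (@rank_inj V)).
  by rewrite eqE spreadA cA; case: eqP => // _; rewrite agr2.
apply: wp_skip => z; rewrite agr2 //; case: eqVneq => // ->.
by rewrite lab1 ltnn spreadA cA.
Qed.

Section Select.
Variables (s : nat) (arc : expr) (f : V -> nat) (T' : tournament V).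
Hypothesis arcE : forall x y m, m inner_cell 0 = rank x ->
  m outer_cell 0 = rank y -> valid m -> eval m arc = T' y x.

Let deg y := #|level f s :&: out_nbhd T' y|.

Definition least_degree_below i (m : memory) :=
  (forall y, y \in level f s -> rank y < i -> m degree_cell 0 <= deg y) /\
  (m degree_cell 0 = #|V|.+1 \/ exists2 v, v \in level f s &
     m choice_cell 0 = rank v /\ m degree_cell 0 = deg v).

Lemma least_degree_belowS m m' y : least_degree_below (rank y) m ->
  (if (y \in level f s) && (deg y < m degree_cell 0)
   then m' choice_cell 0 = rank y /\ m' degree_cell 0 = deg y
   else m' choice_cell 0 = m choice_cell 0 /\
        m' degree_cell 0 = m degree_cell 0) ->
  least_degree_below (rank y).+1 m'.
Proof.
move=> [mmin arg]; case: ifP => [/andP[ys lt_deg]|notless] [m'arg m'deg].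
  split=> [x xs|]; last by right; exists y.
  rewrite rank_ltS m'deg => /predU1P[->//|xy].
  exact: leq_trans (ltnW lt_deg) (mmin x xs xy).
split=> [x xs|]; last by rewrite m'arg m'deg.
rewrite rank_ltS m'deg => /predU1P[xy|]; last exact: mmin.
by rewrite xy in xs *; move/negbT: notless; rewrite xs -leqNgt.
Qed.

Lemma least_degree_below_card m : level f s != set0 ->
  least_degree_below #|V| m ->
  exists2 v, min_outdegree T' (level f s) v & m choice_cell 0 = rank v.
Proof.
case/set0Pn=> x xs [mmin [big|[v vs [mv mdeg]]]].
  by have := mmin x xs (rank_lt x); rewrite big leqNgt ltnS max_card.
exists v => //; split=> // y ys; rewrite -/(deg v) -mdeg.
exact: mmin ys (rank_lt y).
Qed.

Lemma wp_select_body m y : m outer_cell 0 = rank y -> stores label_array m f ->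
  least_degree_below (rank y) m ->
  wp (select_body (Const s) arc) m (least_degree_below (rank y).+1).
Proof.
move=> my mf Iy; apply: wp_seq.
  apply: (wp_count (A := level f s :&: out_nbhd T' y)) => // x m1 m1x vm1 agr1.
  have m1y : m1 outer_cell 0 = rank y by rewrite agr1.
  rewrite /= (arcE m1x m1y vm1) m1x agr1 // mf !inE.
  by case: (f x == s); case: (T' y x).
move=> m1 vm1 agr1 m1deg; rewrite -/(deg y) in m1deg; rewrite /= in agr1.
have cond : eval m1 (Bin Mul (Bin Eqn (Get label_array outer) (Const s))
    (Bin Leq (Bin Add (scalar count_cell) (Const 1)) (scalar degree_cell))) =
  ((y \in level f s) && (deg y < m degree_cell 0)).
  by rewrite /= m1deg !agr1 // my mf addn1 inE mulnb.
apply: wp_if; rewrite // cond; last move/eqP; rewrite eqb0 ?negbK => less.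
  apply: (wp_seq (P := fun m' => m' choice_cell 0 = rank y)).
    apply: wp_set; rewrite //= agr1 // my //.
    by rewrite cell_lt // (leq_trans (ltnW (rank_lt y))) ?leq_addr.
  move=> m2 vm2 agr2 m2y; have m2deg : m2 count_cell 0 = deg y by rewrite agr2.
  apply: wp_set => //=; first by case: vm2.
  by apply: least_degree_belowS Iy _; rewrite less /update /= m2deg.
apply: wp_skip; apply: least_degree_belowS Iy _.
by rewrite (negPf less) !agr1.
Qed.

Lemma wp_select m : stores label_array m f -> level f s != set0 ->
  wp (select_prog (Const s) arc) m (fun m' =>
    exists2 v, min_outdegree T' (level f s) v & m' choice_cell 0 = rank v).
Proof.
move=> mf s0; apply: wp_valid => vm; have [mV _ _ _] := valid_encodes vm.
apply: (wp_seq
    (P := fun m' => m' degree_cell 0 = #|V|.+1 /\ stores label_array m' f)).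
  by apply: wp_set; rewrite //= mV addn1 // cell_lt // -addn1 leq_add2l.
move=> m1 _ agr1 [m1deg lab1].
apply: wp_conseq (wp_for_vertices (I := least_degree_below) _ _ _ _) _ => //.
- by split=> //; left.
- move=> y m2 m2y _ agr2 Iy; apply: wp_select_body => // x.
  by rewrite agr2.
by move=> m' _ _; apply: least_degree_below_card.
Qed.

End Select.

Lemma wp_place_all body c m (I : nat -> (V -> nat) -> Prop) :
  round_cell \notin writes body ->
  c \notin [:: inner_cell; round_cell; count_cell] ->
  (exists2 f, stores label_array m f & I (m c 0) f) ->
  (forall m' f, valid m' -> agree_off (writes (place_all_prog body)) m m' ->
     stores label_array m' f -> I (m' c 0) f -> unplaced f != set0 ->
     wp body m' (fun m'' => exists f', [/\ stores label_array m'' f',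
       I (m'' c 0) f' & unplaced f' \proper unplaced f])) ->
  wp (place_all_prog body) m (fun m' =>
    exists f, [/\ stores label_array m' f, I (m' c 0) f & unplaced f = set0]).
Proof.
rewrite !inE !negb_or => rbody /and3P[ci cr cc] [f0 lab0 If0] step.
pose J i (m' : memory) := exists f, [/\ stores label_array m' f, I (m' c 0) f &
  #|unplaced f| <= #|V| - i].
apply: wp_conseq (wp_for_vertices (I := J) _ _ _ _) _ => //.
- by rewrite /= !inE cats0.
- by exists f0; rewrite /update (negPf cr) subn0 max_card.
- move=> x m1 m1x vm1 agr1 [f [lab1 If cU]].
  apply: wp_seq.
    apply: (wp_count (A := unplaced f)) => // y m2 m2y vm2 agr2.
    by rewrite /= m2y agr2 // lab1 inE.
  move=> m2 vm2 agr2 m2U; have lab2 : stores label_array m2 f.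
    by move=> y; rewrite agr2.
  have m2c : m2 c 0 = m1 c 0 by rewrite agr2 //= !inE (negPf ci) (negPf cc).
  apply: wp_if; rewrite //= m2U.
    rewrite cards_eq0 => U0; rewrite -m2c in If.
    have agr : agree_off (writes (place_all_prog body)) m m2.
      apply: agree_off_trans agr1 (agree_offS _ agr2) => a.
      by rewrite /= !inE => /or3P[]/eqP->; rewrite eqxx ?orbT.
    have := step m2 f vm2 agr lab2 If U0.
    move=> /wp_conseq; apply=> m3 _ _ [f' [lab3 If' ltU]].
    exists f'; rewrite /update (negPf cr); split=> //.
    by have := leq_trans (proper_card ltU) cU; have := rank_lt x; lia.
  move=> U0; apply: wp_skip; exists f; rewrite /update (negPf cr) U0 /=.
  by split=> //; rewrite m2c.
move=> m' _ _ [f [lab' If]]; rewrite subnn leqn0 cards_eq0 => /eqP U0.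
by exists f.
Qed.

Lemma stores_update a m f v q i : stores a m f -> i = rank v ->
  stores a (update m a i q) [eta f with v |-> q].
Proof.
by move=> mf -> x; rewrite /update eqxx /= (inj_eq (@rank_inj V)) mf.
Qed.

Lemma eval_mod m e d : eval m (mod_expr e d) = eval m e %% d.
Proof. by rewrite /= [X in X - _](divn_eq _ d) mulnC addnC addnK. Qed.

Lemma wp_pivot m f : stores label_array m f -> unplaced f != set0 ->
  wp pivot_prog m (fun m' =>
    exists2 v, pivot T f v & m' choice_cell 0 = rank v).
Proof.
move=> mf U0; apply: wp_seq.
  apply: (wp_count (A := level f 1)) => // x m1 m1x vm1 agr1.
  by rewrite /= m1x agr1 // mf inE.
move=> m1 vm1 agr1 m1F; have lab1 : stores label_array m1 f.
  by move=> x; rewrite agr1.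
have selectE s (T' : tournament V) arc :
    (forall x y m', m' inner_cell 0 = rank x -> m' outer_cell 0 = rank y ->
       valid m' -> eval m' arc = T' y x) ->
    level f s != set0 ->
    (forall v, min_outdegree T' (level f s) v -> pivot T f v) ->
    wp (select_prog (Const s) arc) m1 (fun m' =>
      exists2 v, pivot T f v & m' choice_cell 0 = rank v).
  move=> arcE s0 piv; apply: wp_conseq (wp_select arcE lab1 s0) _ => m' _ _ [v].
  by exists v; first exact: piv.
apply: wp_if; rewrite //= m1F.
  rewrite cards_eq0 => F0.
  apply: (selectE 1 (converse T)) => // [x y m' m'x m'y vm'|v].
    exact: (@eval_arc _ inner outer).
  by rewrite /pivot (negPf F0).
move/cards0_eq=> F0; apply: (selectE 0 T) => // [x y m' m'x m'y vm'||v].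
- exact: (@eval_arc _ outer inner).
- by move: U0; rewrite unplaced_level F0 setU0.
- by rewrite /pivot F0 eqxx.
Qed.

Lemma wp_split_body m f : obstruction_free T 3 setT ->
  stores label_array m f -> split_invariant T (m next_cell 0) f ->
  unplaced f != set0 ->
  wp split_body m (fun m' => exists f', [/\ stores label_array m' f',
    split_invariant T (m' next_cell 0) f' & unplaced f' \proper unplaced f]).
Proof.
move=> freeT mf inv U0; set j := m next_cell 0 in inv.
have jP : j \in [:: 3; 4] := split_code inv.
apply: wp_seq (wp_pivot mf U0) _ => m1 vm1 agr1 [v pv m1v].
apply: (wp_seq
    (P := fun m' => stores label_array m' [eta f with v |-> 2])).
  apply: wp_set => //=; first exact: const_lt.
  by apply: stores_update => // x; rewrite agr1.
move=> m2 vm2 agr2 lab2; apply: wp_seq.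
  by apply: (wp_spread (p := 2) (q := 5)) lab2 _ _ _ _; rewrite // const_lt.
move=> m3 vm3 agr3 lab3; have m3j : m3 next_cell 0 = j.
  by rewrite agr3 // agr2 // agr1.
apply: wp_seq.
  apply: (wp_spread (p := 5) (q := j)) lab3 _ _ _ _ => //.
  - by move: jP; rewrite !inE => /orP[]/eqP->.
  - by move: jP; rewrite !inE => /orP[]/eqP->; apply: const_lt.
  - by move=> m' _ agr'; rewrite /= agr'.
move=> m4 vm4 agr4 lab4; have m4j : m4 next_cell 0 = j by rewrite agr4.
apply: wp_seq.
  apply: (wp_spread (p := j) (q := 1)) lab4 _ _ _ _ => //.
  - by move: jP; rewrite !inE => /orP[]/eqP->.
  - by move: jP; rewrite !inE => /orP[]/eqP->.
  - exact: const_lt.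
  - by move=> m' _ agr'; rewrite /= agr'.
move=> m5 vm5 agr5 lab5; have m5j : m5 next_cell 0 = j by rewrite agr5.
apply: wp_set; rewrite //= ?m5j.
  by rewrite const_lt // (leq_trans (leq_subr _ _)).
exists (split_step T j f v); split=> //.
- exact: split_step_invariant.
- exact: unplaced_split_step_proper inv pv.
Qed.

Lemma wp_split m : obstruction_free T 3 setT ->
  wp split_prog m (fun m' => exists g, [/\ stores part_array m' g,
    forall x, g x < 3 & forall c, obstruction_free T 2 (level g c)]).
Proof.
move=> freeT; apply: wp_seq.
  by apply: (wp_map (F := fun=> 0)) => // x; rewrite expn_gt0.
move=> m1 vm1 agr1 lab1.
apply: (wp_seq
    (P := fun m' => stores label_array m' (fun=> 0) /\ m' next_cell 0 = 3)).
  apply: wp_set => //=; first exact: const_lt.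
  by split=> // x; exact: lab1.
move=> m2 vm2 _ [lab2 m2j]; apply: wp_seq.
  apply: (wp_place_all (c := next_cell) (I := split_invariant T)) => //.
    by exists (fun=> 0); rewrite ?m2j //; apply: split_init.
  by move=> m' f vm' agr'; apply: wp_split_body.
move=> m3 vm3 agr3 [f [lab3 inv U0]].
apply: wp_conseq (wp_map (F := fun x => f x %% 3) _ _ _ _) _ => //.
- by move=> x; rewrite const_lt // (leq_trans (ltnW (ltn_pmod _ _))).
- by move=> x m' m'x vm' agr'; rewrite eval_mod /= m'x agr' // lab3.
move=> m4 _ _ part4; exists (fun x => f x %% 3).
split=> // [x|c]; first exact: ltn_pmod.
suff -> : level (fun x => f x %% 3) c = part f c by apply: split_part inv c.
apply/setP=> x; move/setP/(_ x): U0; rewrite !inE ltnNge => ->; exact: erefl.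
Qed.

Section Layer.
Variable C : {set V}.
Hypothesis freeC : obstruction_free T 2 C.

Definition bounded_layering t B :=
  layering T C t B /\ t + #|unplaced B| <= #|V| + 4.

Lemma bounded_layeringS t B B' : bounded_layering t B ->
  layering T C t.+1 B' /\ unplaced B' \proper unplaced B ->
  bounded_layering t.+1 B'.
Proof.
move=> [_ small] [lay' /proper_card ltU]; split=> //.
by apply: leq_trans small; rewrite addSnnS leq_add2l.
Qed.

Lemma bounded_layering_lt t B : bounded_layering t B -> t < 2 ^ b.
Proof.
move=> [_ le_t]; apply: cell_lt; apply: leq_trans (leq_addr _ t) _.
by apply: leq_trans le_t _; rewrite leq_add2l.
Qed.

Lemma wp_next_layer m B : stores label_array m B ->
  bounded_layering (m next_cell 0) B -> unplaced B != set0 ->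
  wp next_layer_prog m (fun m' => m' next_cell 0 = m next_cell 0 /\
    exists B', [/\ stores label_array m' B',
      layering T C (m next_cell 0).+1 B' & unplaced B' \proper unplaced B]).
Proof.
move=> mB; set t := m next_cell 0 => -[lay small] U0.
have t4 := layering_start lay.
have tb : t < 2 ^ b by apply: bounded_layering_lt (conj lay small).
apply: wp_seq.
  apply: (wp_spread (p := t.-1) (q := t)) mB _ _ _ _ => //.
  - by rewrite -ltnS (ltn_predK t4) (leq_trans _ t4).
  - by rewrite ltn_eqF // (ltn_predK t4).
  - by move=> m' _ agr'; rewrite /= agr' // subn1.
move=> m1 vm1 agr1; set g := spread T B t.-1 t => lab1.
have m1t : m1 next_cell 0 = t by rewrite agr1.
apply: wp_seq.
  apply: (wp_count (A := level g t)) => // x m2 m2x vm2 agr2.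
  by rewrite /= m2x !agr2 // m1t lab1 inE.
move=> m2 vm2 agr2 m2t; have lab2 : stores label_array m2 g.
  by move=> x; rewrite agr2.
apply: wp_if; rewrite //= m2t.
  rewrite cards_eq0 => gt0; apply: wp_skip; rewrite agr2 //; split=> //.
  by have [lay' ltU] := layering_spread freeC lay gt0; exists g.
move/cards0_eq=> gt0; apply: wp_seq.
  apply: (wp_select (s := 0) (T' := T) _ lab2) => [x y m' m'x m'y vm'|].
    exact: (@eval_arc _ outer inner).
  by rewrite (level_spread_idle 0 gt0) -(unplaced_layering lay).
move=> m3 vm3 agr3 [v vmin m3v]; have m3t : m3 next_cell 0 = t.
  by rewrite agr3 // agr2.
apply: wp_set; rewrite //= m3t //; split=> //.
have [lay' ltU] := layering_restart lay gt0 vmin.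
exists [eta g with v |-> t]; split=> //.
by apply: stores_update m3v => x; rewrite agr3.
Qed.

Lemma wp_layer_body m B : stores label_array m B ->
  bounded_layering (m next_cell 0) B -> unplaced B != set0 ->
  wp layer_body m (fun m' => exists B', [/\ stores label_array m' B',
    bounded_layering (m' next_cell 0) B' & unplaced B' \proper unplaced B]).
Proof.
move=> mB small U0.
apply: wp_seq (wp_next_layer mB small U0) _ => m1 _ _ [m1t].
move=> [B' [lab1 lay' ltU]].
have small' : bounded_layering (m next_cell 0).+1 B'.
  exact: bounded_layeringS small _.
apply: wp_set; rewrite //= m1t addn1.
  exact: bounded_layering_lt small'.
by exists B'.
Qed.

End Layer.

Lemma wp_layer m g : stores part_array m g ->
  obstruction_free T 2 (level g (m part_cell 0)) ->
  wp layer_prog m (fun m' => exists t B, [/\ stores label_array m' B,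
    layering T (level g (m part_cell 0)) t B & unplaced B = set0]).
Proof.
set C := level g _ => mg freeC; pose B0 x := if x \in C then 0 else 2.
apply: wp_seq.
  apply: (wp_map (F := B0)) => // [x|x m' m'x _ agr'].
    by rewrite const_lt // /B0; case: ifP.
  by rewrite /= m'x !agr' // mg /B0 inE; case: eqP.
move=> m1 _ agr1 lab1.
apply: (wp_seq
    (P := fun m' => stores label_array m' B0 /\ m' next_cell 0 = 4)).
  by apply: wp_set => //=; exact: const_lt.
move=> m2 _ _ [lab2 m2t].
have loop := @wp_place_all layer_body next_cell m2 (bounded_layering C).
apply: wp_conseq (loop _ _ _ _) _ => //.
- exists B0 => //; rewrite m2t; split; first exact: layering_init.
  by rewrite addnC leq_add2r max_card.
- by move=> m' B vm' agr' labB; apply: wp_layer_body.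
by move=> m' _ _ [B [labB [lay _] U0]]; exists (m' next_cell 0), B.
Qed.

Section Weights.
Hypothesis den_gt0 : forall x, 0 < den x.

Definition scaled x := num x * (\prod_y den y %/ den x).

Definition scaled_weight K := \sum_(x in K) scaled x.

Hypothesis den_lt : \prod_x den x < 2 ^ b.
Hypothesis weight_lt : \sum_x scaled x < 2 ^ b.

Lemma scaled_weight_lt K : scaled_weight K < 2 ^ b.
Proof.
apply: leq_ltn_trans weight_lt.
by rewrite /scaled_weight [leqRHS](bigID (mem K)) leq_addr.
Qed.

Lemma scaled_weightE K :
  \sum_x (x \in K) * scaled x = scaled_weight K.
Proof.
rewrite /scaled_weight [RHS]big_mkcond; apply: eq_bigr => x _.
by case: (x \in K); rewrite ?mul1n.
Qed.

Lemma wp_weight m : wp weight_prog m (fun m' => stores weight_array m' scaled).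
Proof.
apply: wp_seq.
  apply: (@wp_fold _ _ muln _ _ _ den) => // [i|x m1 m1x vm1 _].
    apply: leq_ltn_trans den_lt.
    rewrite [leqRHS](bigID (fun y => rank y < i)) /=.
    by rewrite leq_pmulr // prodn_cond_gt0.
  by have [_ _ _ denE] := valid_encodes vm1; rewrite /= m1x denE.
move=> m1 vm1 _ m1D; apply: (wp_map (F := scaled)) => // [x|x m2 m2x vm2 agr2].
  by apply: leq_ltn_trans weight_lt; rewrite (bigD1 x) //= leq_addr.
have [_ _ numE denE] := valid_encodes vm2.
by rewrite /= m2x numE denE agr2 // m1D.
Qed.

Definition candidate (m : memory) K :=
  [/\ acyclic T K, stores output_array m (fun x => x \notin K) &
      m best_cell 0 = scaled_weight K].

Definition improved K (P : nat -> Prop) (m : memory) := exists K',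
  [/\ candidate m K', scaled_weight K <= scaled_weight K' &
      P (scaled_weight K')].

Definition kept (g : V -> nat) c B r := [set x in level g c | B x %% 3 != r].

Lemma eval_keep m g B x : m inner_cell 0 = rank x ->
  stores part_array m g -> stores label_array m B ->
  eval m keep_expr = (x \in kept g (m part_cell 0) B (m residue_cell 0)).
Proof.
move=> mx mg mB.
have /= labE : eval m (mod_expr (Get label_array inner) 3) = B x %% 3.
  by rewrite eval_mod /= mx mB.
by rewrite /= labE mx mg !inE; case: (g x == _); case: (_ == _).
Qed.

Lemma wp_improve m g B K : stores part_array m g -> stores label_array m B ->
  stores weight_array m scaled -> candidate m K ->
  acyclic T (kept g (m part_cell 0) B (m residue_cell 0)) ->
  wp improve_prog m (improved K
    (leq (scaled_weight (kept g (m part_cell 0) B (m residue_cell 0))))).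
Proof.
move=> mg mB mw [acK outK bestK]; set K1 := kept g _ B _ => acK1.
have keepE m' x : agree_off
      [:: inner_cell; candidate_cell; best_cell; output_array] m m' ->
    m' inner_cell 0 = rank x -> eval m' keep_expr = (x \in K1).
  move=> agr' m'x; have := @eval_keep m' g B x m'x.
  by rewrite !agr' //; apply=> y; rewrite agr'.
apply: wp_seq.
  apply: (wp_sum (F := fun x => (x \in K1) * scaled x)) => //.
    by rewrite scaled_weightE scaled_weight_lt.
  move=> x m1 m1x vm1 agr1; rewrite -mw -m1x.
  have <- : eval m1 keep_expr = (x \in K1).
    by apply: keepE m1x; apply: agree_offS agr1; apply/allP.
  by rewrite -(agr1 weight_array).
rewrite scaled_weightE => m1 vm1 agr1 m1K1.
apply: wp_if; rewrite //= m1K1 agr1 // bestK.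
  rewrite eqb0 negbK => le_K; apply: wp_skip; exists K; split=> //.
  by split; rewrite ?agr1 // => x; rewrite agr1.
move/eqP; rewrite eqb0 -ltnNge => lt_K.
apply: (wp_seq (P := fun m' => m' best_cell 0 = scaled_weight K1)).
  by apply: wp_set; rewrite //= m1K1 // scaled_weight_lt.
move=> m2 vm2 agr2 m2K1.
apply: wp_conseq (wp_map (F := fun x => x \notin K1) _ _ _ _) _ => //.
- by move=> x; rewrite const_lt // (leq_trans (leq_b1 _)).
- move=> x m3 m3x vm3 agr3.
  have <- : 1 - (x \in K1) = (x \notin K1) by case: (x \in K1).
  rewrite -(keepE m3 x _ m3x) //; apply: agree_off_trans (agree_offS _ agr1) _.
    by apply/allP.
  by apply: agree_off_trans (agree_offS _ agr2) (agree_offS _ agr3); apply/allP.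
move=> m3 _ agr3 out3; exists K1; split=> //; last exact: ltnW.
by split=> //; rewrite agr3.
Qed.

Lemma sum_kept_weight g c B :
  \sum_(r < 3) scaled_weight (kept g c B r) = 2 * scaled_weight (level g c).
Proof.
have keptE r : scaled_weight (kept g c B r) =
    \sum_(x in level g c) (B x %% 3 != r) * scaled x.
  transitivity (\sum_(x | (x \in level g c) && (B x %% 3 != r)) scaled x).
    by apply: eq_bigl => x; rewrite inE.
  rewrite big_mkcondr; apply: eq_bigr => x _.
  by case: (_ != r); rewrite ?mul1n.
under eq_bigr do rewrite keptE; rewrite exchange_big big_distrr /=.
apply: eq_bigr => x _; rewrite -big_distrl /= !big_ord_recl big_ord0 /=.
congr (_ * _); have := ltn_pmod (B x) (isT : 0 < 3).
by case: (B x %% 3) => [|[|[|]]].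
Qed.

Lemma wp_residues m g B K : let c := m part_cell 0 in
  stores part_array m g -> stores label_array m B ->
  stores weight_array m scaled -> candidate m K ->
  (forall r, r < 3 -> acyclic T (kept g c B r)) ->
  wp (PFor residue_cell (Const 3) improve_prog) m
    (improved K (fun W => 2 * scaled_weight (level g c) <= 3 * W)).
Proof.
move=> c mg mB mw candK acK.
pose I r := improved K
  (fun W => forall i, i < r -> scaled_weight (kept g c B i) <= W).
apply: wp_conseq (wp_for (M := 3) (I := I) _ _ _ _ _ _ _ _) _ => //.
- by rewrite (leq_trans _ Vn) ?leq_addl.
- exact: const_lt.
- move=> r m1 r3 m1r vm1 agr1 [K1 [cand1 le1 max1]].
  have m1c : m1 part_cell 0 = c by rewrite agr1.
  apply: wp_conseq (@wp_improve m1 g B K1 _ _ _ cand1 _) _.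
  + by move=> x; rewrite agr1.
  + by move=> x; rewrite agr1.
  + by move=> x; rewrite agr1.
  + by rewrite m1c m1r acK.
  rewrite m1c m1r => m2 _ agr2 [K2 [cand2 le2 max2]]; exists K2; split=> //.
    exact: leq_trans le1 le2.
  move=> i; rewrite ltnS leq_eqVlt => /predU1P[-> //|/max1 le_i].
  exact: leq_trans le_i le2.
- by exists K.
move=> m1 _ _ [K1 [cand1 le1 max1]]; exists K1; split=> //.
rewrite -(sum_kept_weight g c B).
apply: leq_trans (_ : \sum_(r < 3) scaled_weight K1 <= _).
  by apply: leq_sum => r _; apply: max1.
by rewrite sum_nat_const card_ord.
Qed.

Lemma wp_part m g K : let c := m part_cell 0 in
  stores part_array m g -> obstruction_free T 2 (level g c) ->
  stores weight_array m scaled -> candidate m K ->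
  wp (layer_prog ;; PFor residue_cell (Const 3) improve_prog) m
    (improved K (fun W => 2 * scaled_weight (level g c) <= 3 * W)).
Proof.
move=> c mg freec mw [acK outK bestK].
apply: wp_seq (wp_layer mg freec) _ => m1 vm1 agr1 [t [B [lab1 lay U0]]].
rewrite -/c in lay; have m1c : m1 part_cell 0 = c by rewrite agr1.
rewrite -m1c; apply: wp_residues lab1 _ _ _ => //.
- by move=> x; rewrite agr1.
- by move=> x; rewrite agr1.
- by split=> // [x|]; rewrite agr1.
move=> r r3; rewrite m1c; apply: layering_acyclic (lay) _ r3.
by rewrite -(unplaced_layering lay).
Qed.

Lemma sum_scaled_levels g : (forall x, g x < 3) ->
  \sum_x scaled x = \sum_(c < 3) scaled_weight (level g c).
Proof.
move=> g3; rewrite (partition_big (fun x => Ordinal (g3 x)) predT) //=.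
by apply: eq_bigr => c _; apply: eq_bigl => x; rewrite inE.
Qed.

Lemma wp_main m : obstruction_free T 3 setT ->
  wp main_prog m (fun m' => exists K,
    candidate m' K /\ 2 * \sum_x scaled x <= 9 * scaled_weight K).
Proof.
move=> freeT; apply: wp_seq (@wp_split m freeT) _ => m1 _ _ [g].
move=> [part1 g3 freeg].
apply: wp_seq (@wp_weight m1) _ => m2 _ agr2 weight2.
apply: (wp_seq (P := fun m' => m' best_cell 0 = 0)).
  by apply: wp_set; rewrite //= expn_gt0.
move=> m3 _ agr3 best3; apply: wp_seq.
  by apply: (wp_map (F := fun=> 1)) => // x; apply: const_lt.
move=> m4 _ agr4 out4.
have part4 : stores part_array m4 g by move=> x; rewrite agr4 // agr3 // agr2.
have weight4 : stores weight_array m4 scaled.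
  by move=> x; rewrite agr4 // agr3.
pose I c m' := exists K, candidate m' K /\
  forall i, i < c -> 2 * scaled_weight (level g i) <= 3 * scaled_weight K.
apply: wp_conseq (wp_for (M := 3) (I := I) _ _ _ _ _ _ _ _) _ => //.
- by rewrite (leq_trans _ Vn) ?leq_addl.
- exact: const_lt.
- move=> c m5 c3 m5c vm5 agr5 [K [candK maxK]].
  apply: wp_conseq (@wp_part m5 g K _ _ _ candK) _.
  + by move=> x; rewrite agr5.
  + by rewrite m5c.
  + by move=> x; rewrite agr5.
  rewrite m5c => m6 _ _ [K' [candK' leK maxK']]; exists K'; split=> // i.
  rewrite ltnS leq_eqVlt => /predU1P[-> //|/maxK le_i].
  by rewrite (leq_trans le_i) // leq_mul2l.
- exists set0; split=> //; split; rewrite /scaled_weight ?big_set0 //.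
  + by rewrite acyclic_card_le2 ?cards0.
  + by move=> x; rewrite /update /= out4 inE.
  + by rewrite /update /= agr4.
move=> m5 _ _ [K [candK maxK]]; exists K; split=> //.
rewrite (sum_scaled_levels g3) big_distrr (_ : 9 = 3 * 3) // -mulnA.
rewrite -[X in _ <= X * _]card_ord -sum_nat_const.
by apply: leq_sum => c _; apply: maxK.
Qed.

End Weights.

End Algorithm.

Import Order.TTheory GRing.Theory Num.Theory.

(** * Polynomial bounds and the encoding *)

Definition is_poly (g : nat -> nat) :=
  exists p : {poly nat}, forall x, p.[x]%R = g x.

Lemma is_poly_const c : is_poly (fun=> c).
Proof. by exists c%:P%R => x; rewrite hornerC. Qed.

Lemma is_poly_id : is_poly id.
Proof. by exists 'X%R => x; rewrite hornerX. Qed.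

Lemma is_poly_add g h : is_poly g -> is_poly h -> is_poly (fun x => g x + h x).
Proof.
by move=> [p pE] [q qE]; exists (p + q)%R => x; rewrite hornerD pE qE.
Qed.

Lemma is_poly_mul g h : is_poly g -> is_poly h -> is_poly (fun x => g x * h x).
Proof.
by move=> [p pE] [q qE]; exists (p * q)%R => x; rewrite hornerM pE qE.
Qed.

Lemma is_poly_succ g : is_poly g -> is_poly (fun x => (g x).+1).
Proof.
by move=> pg; case: (is_poly_add (is_poly_const 1) pg) => p; exists p.
Qed.

Lemma is_poly_cost g h p :
  is_poly g -> is_poly h -> is_poly (fun x => cost (g x) (h x) p).
Proof.
move=> pg ph; have pe e : is_poly (fun x => expr_bound (g x) e).
  apply: is_poly_mul (is_poly_const _) _; apply: is_poly_succ.
  exact: is_poly_mul pg (is_poly_const _).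
have ps i e : is_poly (fun x => set_bound (g x) i e).
  exact/is_poly_succ/is_poly_add.
elim: p => [|a i e|p IHp q IHq|e p IHp q IHq|k e p IHp] /=.
- exact: is_poly_const.
- exact: ps.
- exact/is_poly_succ/is_poly_add.
- by apply/is_poly_succ/is_poly_add => //; apply: is_poly_add.
apply/is_poly_succ/is_poly_add => //.
apply: is_poly_add; last exact: is_poly_succ.
apply: is_poly_mul => //; apply/is_poly_succ/is_poly_add => //.
exact/is_poly_succ/is_poly_add.
Qed.

Lemma nth_allpairs (A B C : Type) (F : A -> B -> C) x0 y0 z0 s t i j :
  i < size s -> j < size t ->
  nth z0 [seq F x y | x <- s, y <- t] (size t * i + j) =
  F (nth x0 s i) (nth y0 t j).
Proof.
elim: s i => [//|x s IHs] [|i] /= lt_i lt_j.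
  by rewrite muln0 add0n nth_cat size_map lt_j (nth_map y0).
rewrite nth_cat size_map ltnNge mulnS -addnA leq_addr /= addKn.
exact: IHs.
Qed.

Lemma leq_prod_bits (I : Type) (r : seq I) (F : I -> nat) :
  \prod_(x <- r) F x <= 2 ^ \sum_(x <- r) bits (F x).
Proof.
elim/big_ind2: _ => [//|x1 x2 y1 y2 le1 le2|x _].
  by rewrite expnD leq_mul.
exact/ltnW/up_logP.
Qed.

Lemma nth_map_rank (V : finType) (F : V -> nat) x :
  nth 0 [seq F y | y <- enum V] (rank x) = F x.
Proof. by rewrite (nth_map x) ?index_mem ?nth_index ?mem_enum. Qed.

Section Encoding.
Variables (V : finType) (T : tournament V) (w : V -> rat).
Implicit Types (x : V) (K : {set V}).

Let N := input_size (encode T w).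
Let input := load (encode T w).

Definition numerator x := absz (numq (w x)).

Definition denominator x := absz (denq (w x)).

Let D := \prod_x denominator x.

Lemma encodes_load : encodes T numerator denominator input.
Proof.
split=> // [x y|x|x]; rewrite ?/input /load /= ?nth_map_rank //.
by rewrite cardE (nth_allpairs _ x y) ?index_mem ?nth_index ?mem_enum.
Qed.

Lemma input_sizeE : N = (bits #|V|).+1 +
  (\sum_(k <- [seq nat_of_bool (T x y) | x <- enum V, y <- enum V])
     (bits k).+1 +
  (\sum_x (bits (numerator x)).+1 + \sum_x (bits (denominator x)).+1)).
Proof.
rewrite /N /input_size /encode !big_cons !big_nil !addn0.
by rewrite !big_map ![index_enum _]unlock.
Qed.

Lemma load_lt a i : input a i < 2 ^ N.
Proof.
rewrite /input /load; set r := nth _ _ a.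
have [ge_i|lt_i] := leqP (size r) i; first by rewrite nth_default ?expn_gt0.
have [ge_a|lt_a] := leqP (size (encode T w)) a.
  by move: lt_i; rewrite /r (nth_default [::]).
apply: leq_trans (up_logP _ (isT : 1 < 2)) _; rewrite leq_exp2l //.
rewrite /N /input_size (big_rem r) ?mem_nth //=.
rewrite (big_rem (nth 0 r i)) ?mem_nth //=.
by rewrite -!addnA (leq_trans (leqnSn _)) // leq_addr.
Qed.

Lemma card_le_input_size : #|V| <= N.
Proof.
rewrite input_sizeE !addnA (leq_trans _ (leq_addl _ _)) //.
by rewrite -sum1_card leq_sum.
Qed.

Lemma denominator_gt0 x : 0 < denominator x.
Proof. by rewrite absz_gt0 denq_neq0. Qed.

Lemma prod_denominator_le : D <= 2 ^ N.
Proof.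
apply: leq_trans (leq_prod_bits _ _) _; rewrite leq_exp2l // input_sizeE.
by rewrite !addnA (leq_trans _ (leq_addl _ _)) // leq_sum.
Qed.

Lemma sum_scaled_le :
  \sum_x scaled numerator denominator x <= 2 ^ (3 * N).
Proof.
apply: leq_trans (_ : #|V| * (2 ^ N * 2 ^ N) <= _).
  rewrite -sum_nat_const leq_sum // => x _; rewrite leq_mul //.
    have [_ _ <- _] := encodes_load; exact/ltnW/load_lt.
  exact: leq_trans (leq_div _ _) prod_denominator_le.
rewrite !mulSn mul0n addn0 !expnD leq_mul2r.
by rewrite (leq_trans card_le_input_size) ?orbT // ltnW // ltn_expl.
Qed.

Lemma natr_scaled_weight K : (forall x, 0 <= w x)%R ->
  ((scaled_weight numerator denominator K)%:R = weight w K * D%:R)%R.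
Proof.
move=> w0; rewrite natr_sum /weight mulr_suml; apply: eq_bigr => x _.
have dvdD : denominator x %| D by rewrite /D (bigD1 x) //= dvdn_mulr.
have numE : ((numerator x)%:R = (numq (w x))%:~R :> rat)%R.
  by rewrite pmulrn gez0_abs // numq_ge0.
have denE : ((denominator x)%:R = (denq (w x))%:~R :> rat)%R.
  by rewrite pmulrn gez0_abs // ltW // denq_gt0.
by rewrite natrM natf_div // numE denE mulrCA divq_num_den mulrC.
Qed.

Lemma weight_setC K : (weight w [set: V] = weight w K + weight w (~: K))%R.
Proof.
rewrite /weight (bigID (mem K)) /=; congr (_ + _)%R; apply: eq_bigl => x;
  by rewrite !inE.
Qed.

Lemma weight_setC_le K : (forall x, 0 <= w x)%R ->
  2 * \sum_x scaled numerator denominator x <=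
    9 * scaled_weight numerator denominator K ->
  (weight w (~: K) <= 7%:R / 9%:R * weight w [set: V])%R.
Proof.
move=> w0 le9.
have D0 : (0 < D%:R :> rat)%R.
  by rewrite ltr0n prodn_gt0 // => x; apply: denominator_gt0.
have : (2%:R * weight w [set: V] <= 9%:R * weight w K)%R.
  rewrite -(ler_pM2r D0) -!mulrA -!natr_scaled_weight // -!natrM ler_nat.
  by rewrite /scaled_weight; under eq_bigl do rewrite inE.
by rewrite (weight_setC K); lra.
Qed.

Lemma main_prog_correct : (forall x, 0 <= w x)%R -> T7_free T ->
  exists m t, [/\ exec (compile main_prog) input m t,
    t <= cost (3 * N + 5) (N + 3) main_prog,
    feedback_vertex_set T (output V m) &
    (weight w (output V m) <= 7%:R / 9%:R * weight w [set: V])%R].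
Proof.
move=> w0 free; set b := 3 * N + 5.
have exp_b : 2 ^ b = 2 ^ (3 * N) * 32 by rewrite expnD.
have N3 : 2 ^ N <= 2 ^ (3 * N) by rewrite leq_exp2l // leq_pmull.
have lt_N := ltn_expl N (isT : 1 < 2); have leV := card_le_input_size.
have b_gt0 : 0 < b by rewrite /b addnS.
have Vb : #|V| + 16 < 2 ^ b by rewrite exp_b; lia.
have bounded_input : bounded b input.
  by move=> a i; apply: leq_trans (load_lt a i) _; rewrite exp_b; lia.
have [|||m [t [ex cost_t _ _ [K [[acK outK _] le9]]]]] :=
  wp_main encodes_load b_gt0 (_ : #|V| + 3 <= N + 3) Vb denominator_gt0 _ _
    (T7_free_obstruction_free free) (conj bounded_input (fun _ _ _ => erefl)).
- by rewrite leq_add2r.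
- by have := prod_denominator_le; rewrite exp_b; lia.
- by have := sum_scaled_le; rewrite exp_b; lia.
have outE : output V m = ~: K.
  by apply/setP=> x; rewrite !inE (outK x) eqb0 negbK.
exists m, t; rewrite outE; split; [exact: ex | exact: cost_t | |].
  by rewrite /feedback_vertex_set setCK; apply/transitive_induced.
exact: weight_setC_le.
Qed.

End Encoding.

Theorem theorem2 :
  exists (alg : cmd) (p : {poly nat}),
  forall (V : finType) (T : tournament V) (w : V -> rat),
    (forall v : V, (0 <= w v)%R) ->
    T7_free T ->
    exists (m : memory) (t : nat),
      [/\ exec alg (load (encode T w)) m t,
          t <= (p.[input_size (encode T w)])%R,
          feedback_vertex_set T (output V m) &
          (weight w (output V m) <= 7%:R / 9%:R * weight w [set: V])%R].
Proof.
have [p pE] : is_poly (fun x => cost (3 * x + 5) (x + 3) main_prog).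
  apply: is_poly_cost; apply: is_poly_add (is_poly_const _).
    exact: is_poly_mul (is_poly_const _) is_poly_id.
  exact: is_poly_id.
exists (compile main_prog), p => V T w w0 free.
have [m [t [ex cost_t fvs le_weight]]] := main_prog_correct w0 free.
by exists m, t; split=> //; rewrite pE.
Qed.
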